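(* Let $m \in \mathbb{N}$. The theory $\text{OCSA-I}_{m,\text{rcf}}$ is model-complete in $L_{\text{CSA-I}} \cup \{\underline{\mathscr{P}}\}$, and the theory $\text{OCSA-I}_{m,\text{rcf}} \cup \{\underline{\mathrm{Trd}} \text{ is the reduced trace}\}$ is model-complete in $L_{\text{CSA-I}} \cup \{\underline{\mathscr{P}}, \underline{\mathrm{Trd}}\}$.
   Context: $L_{\text{CSA-I}} := L_R \cup \{\underline{F}, \underline{\sigma}\}$, where $L_R$ is the language of (unital) rings, $\underline{F}$ is a unary relation symbol and $\underline{\sigma}$ a unary function symbol; $\underline{\mathscr{P}}$ is a unary relation symbol and $\underline{\mathrm{Trd}}$ a unary function symbol. $\text{CSA-I}_m$ is the $L_{\text{CSA-I}}$-theory stating: the structure is a von Neumann regular ring, its centre is a field, $\underline{\sigma}$ is an involution, $\underline{F}$ is the field of all elements of the centre fixed by $\underline{\sigma}$, and the dimension over $\underline{F}$ is $m$. Its models are the central simple algebras with involution $(A,\sigma)$ over $F$ with $\dim_F A = m$. $\text{CSA-I}_{m,\text{rcf}} := \text{CSA-I}_m \cup \{\underline{F} \text{ is real closed}\}$. For a central simple algebra with involution $(A,\sigma)$ over $F$ (so $F = Z(A) \cap \mathrm{Sym}(A,\sigma)$, with $\mathrm{Sym}(A,\sigma) = \{a \in A : \sigma(a)=a\}$), a prepositive cone on $(A,\sigma)$ is a subset $\mathscr{P} \subseteq \mathrm{Sym}(A,\sigma)$ such that: (P1) $\mathscr{P} \neq \varnothing$; (P2) $\mathscr{P}+\mathscr{P}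 \subseteq \mathscr{P}$; (P3) $\sigma(a)\cdot\mathscr{P}\cdot a \subseteq \mathscr{P}$ for every $a \in A$; (P4) $\mathscr{P}_F := \{u \in F : u\mathscr{P} \subseteq \mathscr{P}\}$ is an ordering on $F$; (P5) $\mathscr{P} \cap -\mathscr{P} = \{0\}$. A positive cone is a prepositive cone that is maximal with respect to inclusion. Being a positive cone is a first-order property in models of $\text{CSA-I}_m$. $\text{OCSA-I}_{m,\text{rcf}} := \text{CSA-I}_{m,\text{rcf}} \cup \{\underline{\mathscr{P}} \text{ is a positive cone}\}$. The reduced trace of a central simple algebra $A$ over $K=Z(A)$ is $\mathrm{Trd}_A(a) = \mathrm{tr}(f(a\otimes 1)) \in K$, where $E\supseteq K$ is a splitting field and $f: A\otimes_K E \to M_r(E)$ an $E$-algebra isomorphism. *)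

(* Defs.v *)
From mathcomp Require Import all_boot all_order all_algebra all_field.
From mathcomp Require Import boolp classical_sets.

Set Implicit Arguments.
Unset Strict Implicit.
Unset Printing Implicit Defensive.

Import GRing.Theory.
Local Open Scope classical_set_scope.
Local Open Scope ring_scope.

(** * First-order logic *)

Record language := Language {
  fsym : Type;
  farity : fsym -> nat;
  rsym : Type;
  rarity : rsym -> nat }.

Record structure (L : language) := Structure {
  carrier :> Type;
  finterp : forall f : fsym L, ('I_(farity f) -> carrier) -> carrier;
  rinterp : forall r : rsym L, ('I_(rarity r) -> carrier) -> Prop }.
Arguments finterp {L} _ _ _.
Arguments rinterp {L} _ _ _.

Inductive term (L : language) (n : nat) : Type :=
| Var of 'I_n
| App (f : fsym L) of 'I_(farity f) -> term L n.

(* [formula L n]: formulas with free variables among n variables; [All] binds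
   the variable [ord0]. Satisfaction is classical, so falsity, implication and
   universal quantification suffice. *)
Inductive formula (L : language) : nat -> Type :=
| Bot n : formula L n
| Eq n : term L n -> term L n -> formula L n
| Rel n (r : rsym L) : ('I_(rarity r) -> term L n) -> formula L n
| Imp n : formula L n -> formula L n -> formula L n
| All n : formula L n.+1 -> formula L n.

Definition sentence (L : language) := formula L 0.

Definition scons (T : Type) (n : nat) (x : T) (v : 'I_n -> T) : 'I_n.+1 -> T :=
  fun i => if unlift ord0 i is Some j then v j else x.

Fixpoint eval (L : language) (M : structure L) (n : nat) (v : 'I_n -> M)
    (t : term L n) : M :=
  match t with
  | Var i => v i
  | App f a => finterp M f (fun i => eval v (a i))
  end.

Fixpoint sat (L : language) (M : structure L) (n : nat) (phi : formula L n) :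
    ('I_n -> M) -> Prop :=
  match phi in formula _ n return ('I_n -> M) -> Prop with
  | Bot _ => fun _ => False
  | Eq _ s t => fun v => eval v s = eval v t
  | Rel _ r a => fun v => rinterp M r (fun i => eval v (a i))
  | Imp _ p q => fun v => sat p v -> sat q v
  | All _ p => fun v => forall x : M, sat p (scons x v)
  end.
Arguments sat {L} M {n} phi v.

Definition holds (L : language) (M : structure L) (phi : sentence L) : Prop :=
  forall v : 'I_0 -> M, sat M phi v.

Definition theory (L : language) := set (sentence L).

Definition is_model (L : language) (T : theory L) (M : structure L) : Prop :=
  forall phi, T phi -> holds M phi.

(* [K] is not a [set]: the universe of [structure L] is too large for it. *)
Definition theory_of (L : language) (K : structure L -> Prop) : theory L :=
  [set phi | forall M, K M -> holds M phi].

Definition embedding (L : language) (M N : structure L) (h : M -> N) : Prop :=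
  [/\ injective h,
      forall f a, h (finterp M f a) = finterp N f (h \o a)
    & forall r a, rinterp M r a <-> rinterp N r (h \o a)].

Definition elementary (L : language) (M N : structure L) (h : M -> N) : Prop :=
  forall n (phi : formula L n) (v : 'I_n -> M),
    sat M phi v <-> sat N phi (h \o v).

Definition model_complete (L : language) (T : theory L) : Prop :=
  forall M N : structure L, is_model T M -> is_model T N ->
  forall h : M -> N, embedding h -> elementary h.

Definition add_rsym (L : language) (k : nat) : language :=
  {| fsym := fsym L; farity := @farity L;
     rsym := option (rsym L);
     rarity := fun r => if r is Some r' then rarity r' else k |}.

Definition add_fsym (L : language) (k : nat) : language :=
  {| fsym := option (fsym L);
     farity := fun f => if f is Some f' then farity f' else k;
     rsym := rsym L; rarity := @rarity L |}.

Definition expand_rel (L : language) (k : nat) (M : structure L)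
    (R : ('I_k -> M) -> Prop) : structure (add_rsym L k) :=
  @Structure (add_rsym L k) M (finterp M)
    (fun r => match r return ('I_(@rarity (add_rsym L k) r) -> M) -> Prop with
              | Some r' => rinterp M r'
              | None => R
              end).

Definition expand_fun (L : language) (k : nat) (M : structure L)
    (g : ('I_k -> M) -> M) : structure (add_fsym L k) :=
  @Structure (add_fsym L k) M
    (fun f => match f return ('I_(@farity (add_fsym L k) f) -> M) -> M with
              | Some f' => finterp M f'
              | None => g
              end)
    (rinterp M).

(** * Central simple algebras with involution *)

Section Involution.
Variables (F : fieldType) (A : falgType F).
Implicit Types (sigma : A -> A) (P : set A).

Definition von_neumann_regular : Prop := forall a : A, exists x, a * x * a = a.

Definition centre_is_field : Prop :=
  forall z : A, z \in 'Z({:A})%VS -> z != 0 ->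
  exists2 w, w \in 'Z({:A})%VS & z * w = 1.

Definition involution sigma : Prop :=
  [/\ forall a b, sigma (a + b) = sigma a + sigma b,
      forall a b, sigma (a * b) = sigma b * sigma a
    & forall a, sigma (sigma a) = a].

Definition Sym sigma : set A := [set a | sigma a = a].

(* The base field, as a subset of the algebra. *)
Definition base_field : set A := [set a | exists k : F, a = k%:A].

Definition csa_with_involution (m : nat) sigma : Prop :=
  [/\ von_neumann_regular,
      centre_is_field,
      involution sigma,
      base_field = [set a | a \in 'Z({:A})%VS] `&` Sym sigma
    & (\dim {:A} = m)%N].

Definition ordering (O : set F) : Prop :=
  [/\ forall u v, O u -> O v -> O (u + v),
      forall u v, O u -> O v -> O (u * v),
      forall u, O u \/ O (- u)
    & forall u, (O u /\ O (- u)) <-> u = 0].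

Record prepositive_cone sigma P : Prop := PrepositiveCone {
  pc_sym : P `<=` Sym sigma;
  pc_nonempty : P !=set0;
  pc_add : forall a b, P a -> P b -> P (a + b);
  pc_conj : forall a p, P p -> P (sigma a * p * a);
  pc_ordering : ordering [set u : F | forall p, P p -> P (u *: p)];
  pc_pointed : forall a, (P a /\ P (- a)) <-> a = 0 }.

Definition positive_cone sigma P : Prop :=
  prepositive_cone sigma P /\
  forall Q, prepositive_cone sigma Q -> P `<=` Q -> Q = P.

(** * Reduced trace *)

Definition centre := subvs_of 'Z({:A})%AS.

(* [B], with [j] in the role of a |-> a (x) 1, is the E-algebra A (x)_K E, where
   K is the centre of [A] and [iota : K -> E]: [j] is a ring morphism which is
   universal among K-linear maps from [A] to E-vector spaces. *)
Definition scalar_extension (E : fieldType) (iota : {rmorphism centre -> E})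
    (B : algType E) (j : {rmorphism A -> B}) : Prop :=
  (forall (z : centre) (a : A), j (vsval z * a) = iota z *: j a) /\
  forall (V : lmodType E) (h : {additive A -> V}),
    (forall (z : centre) (a : A), h (vsval z * a) = iota z *: h a) ->
    (exists g : {linear B -> V}, forall a, g (j a) = h a) /\
    (forall g g' : {linear B -> V},
       (forall a, g (j a) = h a) -> (forall a, g' (j a) = h a) -> g =1 g').

Definition reduced_trace (Trd : A -> A) : Prop :=
  exists (E : fieldType) (iota : {rmorphism centre -> E})
         (B : algType E) (j : {rmorphism A -> B})
         (r : nat) (f : {lrmorphism B -> 'M[E]_r.+1}),
    [/\ scalar_extension iota j,
        bijective f
      & forall a, exists2 t : centre, Trd a = vsval t & iota t = \tr (f (j a))].

End Involution.

(** * Languages and theories *)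

Inductive csa_fsym := csa_zero | csa_one | csa_add | csa_opp | csa_mul | csa_sigma.

Definition csa_farity (f : csa_fsym) : nat :=
  match f with
  | csa_zero | csa_one => 0%N
  | csa_opp | csa_sigma => 1%N
  | csa_add | csa_mul => 2%N
  end.

(* The only relation symbol is the unary symbol for the base field. *)
Definition L_CSA_I : language :=
  {| fsym := csa_fsym; farity := csa_farity;
     rsym := unit; rarity := fun _ => 1%N |}.

Definition L_CSA_I_P : language := add_rsym L_CSA_I 1.

Definition L_CSA_I_P_Trd : language := add_fsym L_CSA_I_P 1.

Definition csa_finterp (F : fieldType) (A : falgType F) (sigma : A -> A)
    (f : csa_fsym) : ('I_(csa_farity f) -> A) -> A :=
  match f return ('I_(csa_farity f) -> A) -> A with
  | csa_zero => fun _ => 0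
  | csa_one => fun _ => 1
  | csa_add => fun a => a ord0 + a ord_max
  | csa_opp => fun a => - a ord0
  | csa_mul => fun a => a ord0 * a ord_max
  | csa_sigma => fun a => sigma (a ord0)
  end.

Definition csa_structure (F : fieldType) (A : falgType F) (sigma : A -> A) :
    structure L_CSA_I :=
  @Structure L_CSA_I A (csa_finterp sigma) (fun _ a => base_field (a ord0)).

Definition ocsa_structure (F : fieldType) (A : falgType F) (sigma : A -> A)
    (P : set A) : structure L_CSA_I_P :=
  @expand_rel L_CSA_I 1 (csa_structure sigma) (fun a => P (a ord0)).

Definition ocsa_trd_structure (F : fieldType) (A : falgType F)
    (sigma : A -> A) (P : set A) (Trd : A -> A) : structure L_CSA_I_P_Trd :=
  @expand_fun L_CSA_I_P 1 (ocsa_structure sigma P) (fun a => Trd (a ord0)).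

Inductive ocsa_rcf (m : nat) : structure L_CSA_I_P -> Prop :=
| OcsaRcf (F : rcfType) (A : falgType F) (sigma : A -> A) (P : set A) of
    csa_with_involution m sigma & positive_cone sigma P :
    ocsa_rcf m (ocsa_structure sigma P).

Inductive ocsa_rcf_trd (m : nat) : structure L_CSA_I_P_Trd -> Prop :=
| OcsaRcfTrd (F : rcfType) (A : falgType F) (sigma : A -> A) (P : set A)
    (Trd : A -> A) of
    csa_with_involution m sigma & positive_cone sigma P & reduced_trace Trd :
    ocsa_rcf_trd m (ocsa_trd_structure sigma P Trd).

(* Maximality of a prepositive cone and being the reduced trace are not
   first-order as phrased, but they are first-order properties of the algebras
   considered. Each theory is therefore given by the sentences true in all the
   intended models (up to isomorphism, every intended model is in [ocsa_rcf],
   resp. [ocsa_rcf_trd]); this is the deductive closure of any axiomatization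
   of this class. *)
Definition OCSA_I_rcf (m : nat) : theory L_CSA_I_P :=
  theory_of (ocsa_rcf m).

Definition OCSA_I_rcf_Trd (m : nat) : theory L_CSA_I_P_Trd :=
  theory_of (ocsa_rcf_trd m).

(* Main.v *)
From mathcomp Require Import all_boot all_order all_algebra all_field.
From mathcomp Require Import boolp classical_sets.
From mathcomp Require Import qe_rcf_th complex.
From mathcomp Require qe_rcf.
Require Import Defs.

(** Let (A, sigma) be a central simple algebra with involution of dimension m
    over a real closed field F, with a positive cone P. After the choice of an
    F-basis, the ring structure and sigma are given by structure constants in
    F. The cone is given by finitely many scalars as well, because over a real
    closed field every nonzero p in P generates it: P is the set of the sums
    of m terms sigma(x) p x ([cone_generated]). The reduced trace is F-linear,
    so a matrix describes it. Therefore a first-order property of a tuple of A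
    is a first-order property, in the ordered field F, of the structure
    constants and of the coordinates of the tuple, and quantifier elimination
    makes it quantifier-free, by a formula that does not depend on F
    ([qf_exists], [semialg_sat]).

    This gives an existential definition of every formula phi
    ([sat_preserved]): there are e_1, ..., e_m in A and elements of F, to be
    the structure constants and the coordinates of the given tuple and of an
    element of P, which satisfy the multiplication table and a quantifier-free
    condition. One has to ensure that the e_i form a basis, which is not
    existential as it stands. So the quantifier-free condition also says that
    the algebra on F^m with these structure constants is simple: then its
    unital homomorphism to A given by the e_i is injective
    ([ssimple_lin_inj]), hence bijective since dim A = m. Formulas of this
    existential kind go up along embeddings. As phi and its negation are both
    equivalent to such formulas, embeddings between models are elementary
    ([model_complete_preserved]).

    The generation of the cone rests on three facts. First, elements of P are
    anisotropic: if sigma(x) p x = 0 then p x = 0 ([anisotropic]), since in a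
    hyperbolic plane p would take opposite nonzero values, all of them in P.
    Next, Gram-Schmidt orthogonalization works: if a is in P and
    t = sigma(z) a z is nonzero, then a = a1 + sigma(x) t x where a1 is in P
    and has a larger right annihilator ([rank_reduction]). Finally, if t has
    minimal rank among the nonzero sigma(x) p x, then t k t is an F-multiple of
    t for every symmetric k ([minimal_rank_scalar]): it is algebraic over F in
    a suitable algebra structure on t A t, and a symmetric square root of -1
    in this algebra would put -t in P. For a in P and z in A t, if
    sigma(z) a z is not 0, then it is a positive multiple of t, hence of the
    form sigma(y) p y; at most m reductions exhaust a.

    In the language without the trace symbol, the same argument applies to the
    identity function in place of the trace ([model_complete_expand_id]). *)

Set Implicit Arguments.
Unset Strict Implicit.
Unset Printing Implicit Defensive.

Import Order.TTheory GRing.Theory Num.Theory.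
Local Open Scope ring_scope.

(** * Quantifier elimination uniform in the real closed field *)

Section MapQF.
Variables (F G : realFieldType) (f : {rmorphism F -> G}).

(** The elimination procedure is defined over an arbitrary ordered field, and
    its correctness is known for each real closed field separately. To obtain
    a single formula for all real closed fields, the procedure is run with
    rational constants; a formula over the rationals is then read in a real
    closed field through this renaming of constants. *)
Fixpoint tmap (t : qe_rcf.term F) : qe_rcf.term G :=
  match t with
  | qe_rcf.Var i => qe_rcf.Var _ i
  | qe_rcf.Const c => qe_rcf.Const (f c)
  | qe_rcf.NatConst n => qe_rcf.NatConst _ n
  | qe_rcf.Add t u => qe_rcf.Add (tmap t) (tmap u)
  | qe_rcf.Opp t => qe_rcf.Opp (tmap t)
  | qe_rcf.NatMul t n => qe_rcf.NatMul (tmap t) n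
  | qe_rcf.Mul t u => qe_rcf.Mul (tmap t) (tmap u)
  | qe_rcf.Exp t n => qe_rcf.Exp (tmap t) n
  end.

Fixpoint fmap (p : qe_rcf.formula F) : qe_rcf.formula G :=
  match p with
  | qe_rcf.Bool b => qe_rcf.Bool b
  | qe_rcf.Equal t u => qe_rcf.Equal (tmap t) (tmap u)
  | qe_rcf.Lt t u => qe_rcf.Lt (tmap t) (tmap u)
  | qe_rcf.Le t u => qe_rcf.Le (tmap t) (tmap u)
  | qe_rcf.And p q => qe_rcf.And (fmap p) (fmap q)
  | qe_rcf.Or p q => qe_rcf.Or (fmap p) (fmap q)
  | qe_rcf.Implies p q => qe_rcf.Implies (fmap p) (fmap q)
  | qe_rcf.Not p => qe_rcf.Not (fmap p)
  end.

Notation pmap := (map tmap).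

(** The elimination procedure is written in continuation-passing style: a
    procedure [S] takes a continuation [k] and returns the formula that
    branches on the possible results. The lemmas below say, for each
    procedure, that it commutes with a field morphism as soon as its
    continuation does; each one holds because the procedure only branches on
    formulas and never inspects the constants. *)
Lemma fmap_Size p k k' : (forall n, fmap (k n) = k' n) ->
  fmap (qe_rcf.Size p k) = qe_rcf.Size (pmap p) k'.
Proof.
elim: p k k' => [|c p IH] k k' kE; first exact: kE.
by apply: IH => -[|n] /=; rewrite ?kE //= !kE.
Qed.

Lemma fmap_Isnull p k k' : (forall b, fmap (k b) = k' b) ->
  fmap (qe_rcf.Isnull p k) = qe_rcf.Isnull (pmap p) k'.
Proof. by move=> kE; apply: fmap_Size => n; apply: kE. Qed.

Lemma fmap_LtSize p q k k' : (forall b, fmap (k b) = k' b) ->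
  fmap (qe_rcf.LtSize p q k) = qe_rcf.LtSize (pmap p) (pmap q) k'.
Proof. by move=> kE; do 2![apply: fmap_Size => ?]; apply: kE. Qed.

Lemma fmap_LeadCoef p k k' : (forall t, fmap (k t) = k' (tmap t)) ->
  fmap (qe_rcf.LeadCoef p k) = qe_rcf.LeadCoef (pmap p) k'.
Proof.
elim: p k k' => [|c p IH] k k' kE /=; first by rewrite kE /= rmorph0.
by apply: IH => t /=; rewrite !kE.
Qed.

Lemma map_AmulXn a n : pmap (qe_rcf.AmulXn a n) = qe_rcf.AmulXn (tmap a) n.
Proof. by elim: n => //= n ->; rewrite rmorph0. Qed.

Lemma map_AddPoly p q :
  pmap (qe_rcf.AddPoly p q) = qe_rcf.AddPoly (pmap p) (pmap q).
Proof. by elim: p q => [|a p IH] [|b q] //=; rewrite IH. Qed.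

Lemma map_ScalPoly c p :
  pmap (qe_rcf.ScalPoly c p) = qe_rcf.ScalPoly (tmap c) (pmap p).
Proof. by rewrite /qe_rcf.ScalPoly -!map_comp. Qed.

Lemma map_MulPoly p q :
  pmap (qe_rcf.MulPoly p q) = qe_rcf.MulPoly (pmap p) (pmap q).
Proof.
by elim: p q => [|a p IH] q //=; rewrite map_AddPoly map_ScalPoly /= IH.
Qed.

Lemma map_ExpPoly p n : pmap (qe_rcf.ExpPoly p n) = qe_rcf.ExpPoly (pmap p) n.
Proof.
rewrite /qe_rcf.ExpPoly; case: n => [|n] //; rewrite !iteropS.
by elim: n => //= n IH; rewrite map_MulPoly IH.
Qed.

Lemma map_OppPoly p : pmap (qe_rcf.OppPoly p) = qe_rcf.OppPoly (pmap p).
Proof. by rewrite /qe_rcf.OppPoly map_ScalPoly /= rmorphN1. Qed.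

Lemma map_NatMulPoly n p :
  pmap (qe_rcf.NatMulPoly n p) = qe_rcf.NatMulPoly n (pmap p).
Proof. by rewrite /qe_rcf.NatMulPoly map_ScalPoly. Qed.

Lemma map_Deriv p : pmap (qe_rcf.Deriv p) = qe_rcf.Deriv (pmap p).
Proof. by elim: p => //= a p IH; rewrite map_AddPoly /= IH. Qed.

Definition map_div (d : nat * qe_rcf.polyF F * qe_rcf.polyF F) :=
  (d.1.1, pmap d.1.2, pmap d.2).

Lemma fmap_Rediv_rec_loop q sq cq c qq r n k k' :
  (forall d, fmap (k d) = k' (map_div d)) ->
  fmap (qe_rcf.Rediv_rec_loop q sq cq c qq r n k) =
  qe_rcf.Rediv_rec_loop (pmap q) sq (tmap cq) c (pmap qq) (pmap r) n k'.
Proof.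
move=> kE; elim: n c qq r => [|n IH] c qq r /=; apply: fmap_Size => sr;
  case: ifP => _; rewrite ?kE //; apply: fmap_LeadCoef => lr.
  by rewrite kE /map_div /= !(map_AddPoly, map_MulPoly, map_OppPoly, map_AmulXn).
by rewrite IH !(map_AddPoly, map_MulPoly, map_OppPoly, map_AmulXn).
Qed.

Lemma fmap_Rediv p q k k' : (forall d, fmap (k d) = k' (map_div d)) ->
  fmap (qe_rcf.Rediv p q k) = qe_rcf.Rediv (pmap p) (pmap q) k'.
Proof.
move=> kE; apply: fmap_Isnull => -[]; first by rewrite kE /map_div /= rmorph0.
do 2![apply: fmap_Size => ?]; apply: fmap_LeadCoef => lq.
by rewrite (fmap_Rediv_rec_loop _ _ _ _ _ _ _ kE) /= rmorph0.
Qed.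

Lemma fmap_Rmod p q k k' : (forall r, fmap (k r) = k' (pmap r)) ->
  fmap (qe_rcf.Rmod p q k) = qe_rcf.Rmod (pmap p) (pmap q) k'.
Proof. by move=> kE; apply: fmap_Rediv => d; rewrite kE. Qed.

Lemma fmap_Rscal p q k k' : (forall n, fmap (k n) = k' n) ->
  fmap (qe_rcf.Rscal p q k) = qe_rcf.Rscal (pmap p) (pmap q) k'.
Proof. by move=> kE; apply: fmap_Rediv => d; rewrite kE. Qed.

Lemma fmap_Rgcd_loop n p q k k' : (forall r, fmap (k r) = k' (pmap r)) ->
  fmap (qe_rcf.Rgcd_loop n p q k) = qe_rcf.Rgcd_loop n (pmap p) (pmap q) k'.
Proof.
move=> kE; elim: n p q => [|n IH] p q /=; apply: fmap_Rmod => r; apply: fmap_Isnull.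
  by case; rewrite kE.
by case; rewrite ?kE ?IH.
Qed.

Lemma fmap_Rgcd p q k k' : (forall r, fmap (k r) = k' (pmap r)) ->
  fmap (qe_rcf.Rgcd p q k) = qe_rcf.Rgcd (pmap p) (pmap q) k'.
Proof.
move=> kE; apply: fmap_LtSize => -[]; apply: fmap_Isnull => -[]; rewrite ?kE //;
  by apply: fmap_Size => n; apply: fmap_Rgcd_loop.
Qed.

Lemma fmap_BigRgcd ps k k' : (forall r, fmap (k r) = k' (pmap r)) ->
  fmap (qe_rcf.BigRgcd ps k) = qe_rcf.BigRgcd (map pmap ps) k'.
Proof.
elim: ps k k' => [|p ps IH] k k' kE /=; first by rewrite kE /= rmorph0.
by apply: IH => r; apply: fmap_Rgcd.
Qed.

Lemma fmap_Changes s k k' : (forall n, fmap (k n) = k' n) ->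
  fmap (qe_rcf.Changes s k) = qe_rcf.Changes (pmap s) k'.
Proof.
elim: s k k' => [|a s IH] k k' kE /=; first exact: kE.
by apply: IH => n /=; rewrite !kE; case: (s).
Qed.

Lemma fmap_SeqPInfty ps k k' : (forall r, fmap (k r) = k' (pmap r)) ->
  fmap (qe_rcf.SeqPInfty ps k) = qe_rcf.SeqPInfty (map pmap ps) k'.
Proof.
elim: ps k k' => [|p ps IH] k k' kE /=; first exact: kE.
by apply: fmap_LeadCoef => l; apply: IH => r; rewrite kE.
Qed.

Lemma fmap_SeqMInfty ps k k' : (forall r, fmap (k r) = k' (pmap r)) ->
  fmap (qe_rcf.SeqMInfty ps k) = qe_rcf.SeqMInfty (map pmap ps) k'.
Proof.
elim: ps k k' => [|p ps IH] k k' kE /=; first exact: kE.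
apply: fmap_LeadCoef => l; apply: fmap_Size => n; apply: IH => r.
by rewrite kE /= rmorphN1.
Qed.

Lemma fmap_ChangesPoly ps k k' : (forall n, fmap (k n) = k' n) ->
  fmap (qe_rcf.ChangesPoly ps k) = qe_rcf.ChangesPoly (map pmap ps) k'.
Proof.
move=> kE; apply: fmap_SeqMInfty => r; apply: fmap_SeqPInfty => s.
by do 2![apply: fmap_Changes => ?].
Qed.

Lemma fmap_NextMod p q k k' : (forall r, fmap (k r) = k' (pmap r)) ->
  fmap (qe_rcf.NextMod p q k) = qe_rcf.NextMod (pmap p) (pmap q) k'.
Proof.
move=> kE; apply: fmap_LeadCoef => l; apply: fmap_Rscal => n.
by apply: fmap_Rmod => r; rewrite kE map_ScalPoly.
Qed.

Lemma fmap_ModsAux p q n k k' : (forall r, fmap (k r) = k' (map pmap r)) ->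
  fmap (qe_rcf.ModsAux p q n k) = qe_rcf.ModsAux (pmap p) (pmap q) n k'.
Proof.
elim: n p q k k' => [|n IH] p q k k' kE /=; first exact: kE.
apply: fmap_Isnull => -[]; first exact: kE.
by apply: fmap_NextMod => r; apply: IH => s; rewrite kE.
Qed.

Lemma fmap_Mods p q k k' : (forall r, fmap (k r) = k' (map pmap r)) ->
  fmap (qe_rcf.Mods p q k) = qe_rcf.Mods (pmap p) (pmap q) k'.
Proof. by move=> kE; do 2![apply: fmap_Size => ?]; apply: fmap_ModsAux. Qed.

Lemma map_PolyComb sq sc :
  pmap (qe_rcf.PolyComb sq sc) = qe_rcf.PolyComb (map pmap sq) sc.
Proof.
rewrite /qe_rcf.PolyComb size_map; elim: (iota _ _) => //= i s IH.
rewrite map_MulPoly IH map_ExpPoly; congr (qe_rcf.MulPoly (qe_rcf.ExpPoly _ _) _).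
case: (ltnP i (size sq)) => lei; first by rewrite (nth_map [::]).
by rewrite !nth_default ?size_map.
Qed.

Lemma map_Pcq sq i : pmap (qe_rcf.Pcq sq i) = qe_rcf.Pcq (map pmap sq) i.
Proof.
rewrite /qe_rcf.Pcq size_map; case: (ltnP i (size (sg_tab (size sq)))) => lei.
  by rewrite !(nth_map [::]) // map_PolyComb.
by rewrite !nth_default // size_map.
Qed.

Lemma fmap_TaqR p q k k' : (forall n, fmap (k n) = k' n) ->
  fmap (qe_rcf.TaqR p q k) = qe_rcf.TaqR (pmap p) (pmap q) k'.
Proof.
move=> kE; rewrite /qe_rcf.TaqR -map_Deriv -map_MulPoly.
by apply: fmap_Mods => r; apply: fmap_ChangesPoly.
Qed.

Lemma fmap_TaqsR p sq i k k' : (forall t, fmap (k t) = k' (tmap t)) ->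
  fmap (qe_rcf.TaqsR p sq i k) = qe_rcf.TaqsR (pmap p) (map pmap sq) i k'.
Proof.
move=> kE; rewrite /qe_rcf.TaqsR -map_Pcq.
by apply: fmap_TaqR => n; rewrite kE /= rmorph_int.
Qed.

Lemma map_BoundingPoly sq :
  pmap (qe_rcf.BoundingPoly sq) = qe_rcf.BoundingPoly (map pmap sq).
Proof.
rewrite /qe_rcf.BoundingPoly map_Deriv; congr qe_rcf.Deriv.
by elim: sq => //= p sq IH; rewrite map_MulPoly IH.
Qed.

(** These coefficients are entries of the inverse of an integer matrix. *)
Lemma rmorph_coefs n i : f (coefs F n i) = coefs G n i.
Proof.
rewrite /coefs; case: (ltnP i (3 ^ n)) => lei; last first.
  by rewrite !nth_default ?rmorph0 // size_map size_enum_ord.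
rewrite !(nth_map (Ordinal lei)) ?size_enum_ord //.
rewrite !castmxE /=; set A := ctmat n.
have ->: map_mx (intr : int -> G) A = map_mx f (map_mx (intr : int -> F) A).
  by apply/matrixP => j k; rewrite !mxE rmorph_int.
  by rewrite -map_invmx mxE.
all: by rewrite -enumT size_enum_ord.
Qed.

Lemma tmap_Coefs n i : tmap (qe_rcf.Coefs F n i) = qe_rcf.Coefs G n i.
Proof.
case: n => [|[|n]] /=; first by rewrite rmorph_nat.
  by rewrite /qe_rcf.Coefs; case: i => [|[|[|i]]] /=;
    rewrite ?nth_nil ?rmorph0 ?fmorphV ?rmorph_nat.
by rewrite /qe_rcf.Coefs rmorph_coefs.
Qed.

Lemma fmap_CcountWeak p sq k k' : (forall t, fmap (k t) = k' (tmap t)) ->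
  fmap (qe_rcf.CcountWeak p sq k) = qe_rcf.CcountWeak (pmap p) (map pmap sq) k'.
Proof.
move=> kE; rewrite /qe_rcf.CcountWeak size_map.
rewrite -[X in _ = _ X _ _]/(tmap (qe_rcf.NatConst _ 0)).
elim: (3 ^ _)%N (qe_rcf.NatConst F 0) => [|n IH] t /=; first exact: kE.
by apply: fmap_TaqsR => u; rewrite IH -tmap_Coefs.
Qed.

(** [CcountGt0 sp sq] states the existence of a common root of [sp] at which
    all of [sq] are positive. *)
Lemma fmap_CcountGt0 sp sq :
  fmap (qe_rcf.CcountGt0 sp sq) = qe_rcf.CcountGt0 (map pmap sp) (map pmap sq).
Proof.
apply: fmap_BigRgcd => p; apply: fmap_Isnull => -[] /=; last first.
  by apply: fmap_CcountWeak.
rewrite -map_BoundingPoly; apply: fmap_CcountWeak => cw /=.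
congr (qe_rcf.Or _ (qe_rcf.Or _ _)).
- by elim: sq => //= q sq ->; congr qe_rcf.And; apply: fmap_LeadCoef.
- elim: sq => //= q sq ->; congr qe_rcf.And; apply: fmap_Size => n.
  exact: fmap_LeadCoef.
Qed.

Lemma map_abstrX i t : pmap (qe_rcf.abstrX i t) = qe_rcf.abstrX i (tmap t).
Proof.
elim: t => //=; first by move=> n; case: ifP.
- by move=> t IHt u IHu; rewrite map_AddPoly IHt IHu.
- by move=> t IHt; rewrite map_OppPoly IHt.
- by move=> t IHt n; rewrite map_NatMulPoly IHt.
- by move=> t IHt u IHu; rewrite map_MulPoly IHt IHu.
- by move=> t IHt n; rewrite map_ExpPoly IHt.
Qed.

End MapQF.
Section UniformQE.

Notation qterm := (qe_rcf.term rat).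
Notation qform := (qe_rcf.formula rat).

Definition teval (R : rcfType) (e : seq R) (t : qterm) : R :=
  qe_rcf.eval e (tmap ratr t).

Definition feval (R : rcfType) (e : seq R) (p : qform) : bool :=
  qe_rcf.qf_eval e (fmap ratr p).

Definition ceval (R : rcfType) (e : seq R) (c : seq qterm * seq qterm) : bool :=
  all (fun t => teval e t == 0) c.1 && all (fun t => 0 < teval e t) c.2.

Definition cand (D E : seq (seq qterm * seq qterm)) :=
  [seq (c.1 ++ d.1, c.2 ++ d.2) | c <- D, d <- E].

Lemma has_cand (R : rcfType) (e : seq R) D E :
  has (ceval e) (cand D E) = has (ceval e) D && has (ceval e) E.
Proof.
rewrite /cand; elim: D => //= c D IH; rewrite has_cat IH andb_orl; congr (_ || _).
rewrite has_map; elim: E {IH} => [|d E IH] /=; rewrite ?andbF // IH andb_orr.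
by congr (_ || _); rewrite /ceval !all_cat andbACA.
Qed.

Notation tsub t u := (qe_rcf.Add t (qe_rcf.Opp u)).

(** A negated literal is a disjunction of literals, because the order is total;
    hence the simultaneous treatment of a formula and its negation. *)
Lemma qf_dnf (p : qform) :
  exists DE : seq (seq qterm * seq qterm) * seq (seq qterm * seq qterm),
  forall (R : rcfType) (e : seq R),
    feval e p = has (ceval e) DE.1 /\ ~~ feval e p = has (ceval e) DE.2.
Proof.
elim: p => [b|t u|t u|t u|p [[D E] IHp] q [[D' E'] IHq]
  |p [[D E] IHp] q [[D' E'] IHq]|p [[D E] IHp] q [[D' E'] IHq]|p [[D E] IHp]].
- exists (if b then ([:: ([::], [::])], [::]) else ([::], [:: ([::], [::])])).
  by case: b.
- exists ([:: ([:: tsub t u], [::])],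
    [:: ([::], [:: tsub t u]); ([::], [:: tsub u t])]) => R e.
  rewrite /= /ceval /= /teval /= !andbT !orbF /feval /=.
  by rewrite subr_eq0 !subr_gt0; split=> //; rewrite neq_lt orbC.
- exists ([:: ([::], [:: tsub u t])],
    [:: ([::], [:: tsub t u]); ([:: tsub u t], [::])]) => R e.
  rewrite /= /ceval /= /teval /= !andbT !orbF /feval /=.
  by rewrite subr_eq0 !subr_gt0; split=> //; rewrite -leNgt le_eqVlt orbC.
- exists ([:: ([::], [:: tsub u t]); ([:: tsub u t], [::])],
    [:: ([::], [:: tsub t u])]) => R e.
  rewrite /= /ceval /= /teval /= !andbT !orbF /feval /=.
  rewrite subr_eq0 !subr_gt0; split; last by rewrite -ltNge.
  by rewrite le_eqVlt orbC eq_sym.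
- exists (cand D D', E ++ E') => R e; rewrite has_cand has_cat.
  have [<- <-] := IHp R e; have [<- <-] := IHq R e.
  by split=> //=; rewrite -negb_and.
- exists (D ++ D', cand E E') => R e; rewrite has_cand has_cat.
  have [<- <-] := IHp R e; have [<- <-] := IHq R e.
  by split=> //=; rewrite -negb_or.
- exists (E ++ D', cand D E') => R e; rewrite has_cand has_cat.
  have [<- <-] := IHp R e; have [<- <-] := IHq R e.
  by split=> //; rewrite -?implybE //= -negb_imply.
- exists (E, D) => R e; have [/= <- <-] := IHp R e.
  by split=> //; rewrite negbK.
Qed.

(** Tarski: the eliminating formula [q] is independent of the real closed field,
    since it is computed over the rationals. The quantifier is distributed
    over the clauses of a disjunctive normal form and removed from each. *)
Lemma qf_exists (p : qform) (i : nat) : exists q : qform,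
  forall (R : rcfType) (e : seq R),
    feval e q <-> exists x, feval (set_nth 0 e i x) p.
Proof.
have [[D E] DE] := qf_dnf p.
pose q (c : seq qterm * seq qterm) := qe_rcf.CcountGt0 (map (qe_rcf.abstrX i) c.1)
                             (map (qe_rcf.abstrX i) c.2).
exists (foldr (fun c r => qe_rcf.Or (q c) r) (qe_rcf.Bool false) D) => R e.
have qP c : feval e (q c) <-> exists x, ceval (set_nth 0 e i x) c.
  rewrite /feval fmap_CcountGt0 qe_rcf.eval_CcountGt0 -!map_comp.
  split=> [/ccount_gt0P[x]|[x cx]]; [move=> cx; exists x|apply/ccount_gt0P; exists x].
    move: cx; rewrite !big_map !big_all /ceval => /andP[h1 h2].
    by apply/andP; split; [apply: sub_all h1|apply: sub_all h2] => t /=;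
       rewrite map_abstrX qe_rcf.abstrXP.
  rewrite !big_map !big_all; case/andP: cx => h1 h2.
  by apply/andP; split; [apply: sub_all h1|apply: sub_all h2] => t /=;
     rewrite map_abstrX qe_rcf.abstrXP.
transitivity (exists x, has (ceval (set_nth 0 e i x)) D); last first.
  by split=> -[x]; exists x; rewrite ?(DE R _).1 // -(DE R _).1.
elim: {DE} D => [|c D IH] /=; first by split=> [|[x]].
rewrite {1}/feval /= -/(feval e (q c)); split.
  by case/orP=> [/qP|/IH] [x cx]; exists x; rewrite cx ?orbT.
by case=> x /orP[cx|cx]; apply/orP; [left; apply/qP|right; apply/IH]; exists x.
Qed.

End UniformQE.

(** * Von Neumann regular algebras whose centre is a field are simple *)

Section Simplicity.
Variables (F : fieldType) (A : falgType F).

Lemma mem_ann_r (a x : A) : (x \in lker (amull a)) = (a * x == 0).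
Proof. by rewrite memv_ker lfunE. Qed.

Lemma mem_ann_l (a x : A) : (x \in lker (amulr a)) = (x * a == 0).
Proof. by rewrite memv_ker lfunE. Qed.

Lemma mem_centre (z : A) : (forall a, z * a = a * z) -> z \in 'Z({:A})%VS.
Proof. by move=> zC; rewrite memv_cap memvf; apply/centvP => a _; rewrite zC. Qed.

Lemma ltn_dimv (V : vectType F) (U W : {vspace V}) v :
  (U <= W)%VS -> v \in W -> v \notin U -> (\dim U < \dim W)%N.
Proof.
move=> sUW vW; apply: contraR; rewrite -leqNgt => le.
by have /eqP-> : U == W by rewrite eqEdim sUW le.
Qed.

Hypotheses (regA : von_neumann_regular A) (fieldZ : centre_is_field A).

(** A nonzero two-sided ideal [I] contains 1. By von Neumann regularity, an
    idempotent [e] of [I] whose left annihilator is minimal is a right unit of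
    [I]: an [x] in [I] with [x * e != x] gives an idempotent [h] of [I]
    orthogonal to [e], and [e + h] has a smaller left annihilator. Regularity
    again shows that [e] commutes with every element, so [e] is an invertible
    idempotent of the centre. *)
Lemma ideal1 (I : A -> Prop) (y : A) :
  (forall a b, I a -> I b -> I (a + b)) -> (forall a b, I b -> I (a * b)) ->
  (forall a b, I a -> I (a * b)) -> I y -> y != 0 -> I 1.
Proof.
move=> ID Il Ir Iy y0.
have I0 : I 0 by rewrite -(mul0r y); apply: Il.
have IN a : I a -> I (- a) by move=> Ia; rewrite -mulN1r; apply: Il.
pose P n := `[< exists e, [/\ I e, e * e = e & \dim (lker (amulr e)) = n] >].
have exP : exists n, P n.
  by exists (\dim (lker (amulr (0 : A)))); apply/asboolP; exists 0; rewrite mul0r.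
case: (ex_minnP exP) => n /asboolP[e [Ie ee dime]] min_e.
have eR x : I x -> x * e = x.
  move=> Ix; apply/eqP; apply/negPn/negP => xe.
  (* [h] is the part of the idempotent [g = c * b] orthogonal to [e]. *)
  pose b := x - x * e; have b0 : b != 0 by rewrite subr_eq0 eq_sym.
  have Ib : I b by apply: ID => //; apply/IN/Ir.
  have be : b * e = 0 by rewrite mulrBl -mulrA ee subrr.
  have [c bcb] := regA b; pose g := c * b; pose h := g - e * g.
  have gg : g * g = g by rewrite /g -mulrA (mulrA b) bcb.
  have ge : g * e = 0 by rewrite /g -mulrA be mulr0.
  have he : h * e = 0 by rewrite mulrBl -(mulrA e) ge mulr0 subrr.
  have eh : e * h = 0 by rewrite mulrBr (mulrA e e) ee subrr.
  have gh : g * h = g by rewrite mulrBr (mulrA g e) ge mul0r subr0 gg.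
  have hh : h * h = h by rewrite {1}/h mulrBl -(mulrA e) gh.
  have bh : b * h = b by rewrite mulrBr (mulrA b e) be mul0r subr0 /g mulrA bcb.
  have h0 : h != 0 by apply: contraNneq b0 => h0; rewrite -bh h0 mulr0.
  pose e' := e + h.
  have Ig : I g by apply: Il.
  have Ih : I h by apply: ID => //; apply/IN/Il.
  have e'e : e' * e = e by rewrite mulrDl ee he addr0.
  have := min_e (\dim (lker (amulr e'))).
  rewrite leqNgt -dime (@ltn_dimv _ _ _ h).
  - suff Pe' : P (\dim (lker (amulr e'))) by move/(_ Pe').
    apply/asboolP; exists e'; split; [exact: ID| |by []].
    by rewrite mulrDr e'e mulrDl eh add0r hh.
  - apply/subvP => z; rewrite !mem_ann_l => /eqP ze'.
    by rewrite -e'e mulrA ze' mul0r.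
  - by rewrite mem_ann_l he.
  - by rewrite mem_ann_l mulrDr he add0r hh.
have eC a : e * a = a * e.
  have <- : e * a * e = a * e.
    apply/eqP; rewrite -subr_eq0; apply/eqP.
    pose d := e * a * e - a * e; rewrite -/d.
    have ed : e * d = 0 by rewrite mulrBr !mulrA ee subrr.
    have Id : I d by apply: ID; [exact/Ir/Ir|exact/IN/Il].
    have [c <-] := regA d.
    by rewrite -(eR _ (Ir d c Id)) -mulrA ed mulr0.
  by rewrite eR //; apply: Ir.
have e0 : e != 0 by apply: contraNneq y0 => e0; rewrite -(eR y Iy) e0 mulr0.
have [w _ ew] := fieldZ (mem_centre eC) e0.
by rewrite -ew -ee -mulrA ew mulr1.
Qed.

End Simplicity.
(** * Prepositive cones over a real closed field *)

(** Multiply the factorization of [q] over the algebraic closure by its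
    conjugate. *)
Lemma rcf_sqr_factor (F : rcfType) (q : {poly F}) : exists s : seq (F * F),
  q ^+ 2 = (lead_coef q ^+ 2)%:P *
           \prod_(z <- s) (('X - z.1%:P) ^+ 2 + (z.2 ^+ 2)%:P).
Proof.
pose f := real_complex F.
have fI : injective (map_poly f) by apply: map_inj_poly (rmorph0 _); apply: complexI.
have [s] := closed_field_poly_normal (map_poly f q).
rewrite lead_coef_map => q1.
have q2 : map_poly f q = f (lead_coef q) *: \prod_(z <- s) ('X - (conjc z)%:P).
  have {1}-> : map_poly f q = map_poly conjc (map_poly f q).
    rewrite -map_poly_comp; apply: eq_map_poly => x /=.
    by congr (_ +i* _)%C; rewrite oppr0.
  rewrite q1 map_polyZ rmorph_prod /=; congr (_ *: _).
    by congr (_ +i* _)%C; rewrite oppr0.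
  by apply: eq_bigr => z _; rewrite map_polyXsubC.
exists [seq (complex.Re z, complex.Im z) | z <- s]; apply: fI.
rewrite rmorphXn rmorphM rmorph_prod /= big_map map_polyC /=.
rewrite expr2 {1}q1 q2 -scalerAl -scalerAr scalerA -big_split /= -mul_polyC.
rewrite rmorphXn expr2; congr (_ * _); apply: eq_bigr => -[a b] _ /=.
rewrite rmorphD rmorphXn /= map_polyXsubC map_polyC /=.
have zE : (a +i* b)%C = f a + 'i%C * f b by rewrite [LHS]complexE.
have zcE : (a +i* - b)%C = f a - 'i%C * f b.
  by rewrite [LHS]complexE /= rmorphN mulrN.
set w : {poly _} := ('i%C * f b)%:P; set y := 'X - (f a)%:P.
have -> : 'X - ((a +i* b)%C)%:P = y - w by rewrite zE polyCD opprD addrA.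
have -> : 'X - ((a +i* - b)%C)%:P = y + w by rewrite zcE polyCB opprB addrA addrAC.
rewrite -subr_sqr /w -polyC_exp exprMn sqr_i mulN1r polyCN opprK.
by congr (_ + _%:P); rewrite expr2 -[RHS]/(f _) -rmorphM -expr2.
Qed.

(** More powers of [a] than the dimension are linearly dependent. *)
Lemma algebraic_elt (F : fieldType) (A : falgType F) (a : A) :
  exists2 q : {poly F}, q != 0 & horner_alg a q = 0.
Proof.
pose n := (\dim {:A}).+1; pose X := [tuple a ^+ i | i < n].
have /freeP nfree : ~~ free X.
  apply/negP; rewrite /free size_tuple => /eqP dimX.
  by have := dimvS (subvf <<X>>%VS); rewrite dimX ltnn.
have [k [kX [i ki]]] : exists k : 'I_n -> F,
    \sum_(i < n) k i *: X`_i = 0 /\ exists i, k i != 0.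
  apply: contrapT => h; apply: nfree => k kX i; apply/eqP/negPn/negP => ki.
  by apply: h; exists k; split=> //; exists i.
exists (\poly_(i < n) k (inord i)).
  apply: contraNneq ki => q0; rewrite -(inord_val i) -(coef0 _ i) -q0.
  by rewrite coef_poly ltn_ord.
rewrite poly_def linear_sum -[RHS]kX; apply: eq_bigr => j _.
rewrite linearZ /= rmorphXn /= horner_algX inord_val mulr_algl.
by rewrite -[X`_j]tnth_nth tnth_mktuple.
Qed.
Section Cones.
Variables (F : rcfType) (A : falgType F) (m : nat) (sigma : A -> A) (P : set A).
Hypotheses (csaA : csa_with_involution m sigma) (coneP : prepositive_cone sigma P).

Notation "x ^s" := (sigma x) (at level 2, left associativity, format "x ^s").

Let sD a b : (a + b)^s = a^s + b^s. Proof. by case: csaA => _ _ []. Qed.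
Let sM a b : (a * b)^s = b^s * a^s. Proof. by case: csaA => _ _ []. Qed.
Let sK a : a^s^s = a. Proof. by case: csaA => _ _ []. Qed.

Let sA (k : F) : (k%:A)^s = k%:A.
Proof.
case: csaA => _ _ _ FE _; have: base_field (k%:A : A) by exists k.
by rewrite FE => -[].
Qed.

Lemma sigmaZ (k : F) a : (k *: a)^s = k *: a^s.
Proof. by rewrite -mulr_algl sM sA mulr_algr. Qed.

Lemma sigma1 : 1^s = 1.
Proof. by rewrite -[X in X^s](scale1r 1) sA scale1r. Qed.

Lemma sigmaN a : (- a)^s = - a^s.
Proof. by rewrite -scaleN1r sigmaZ scaleN1r. Qed.

Lemma sigma0 : 0^s = 0.
Proof. by rewrite -(scale0r 0) sigmaZ !scale0r. Qed.

Lemma sigmaB a b : (a - b)^s = a^s - b^s.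
Proof. by rewrite sD sigmaN. Qed.

Let Psym p : P p -> p^s = p. Proof. exact: (pc_sym coneP). Qed.
Let P0 : P 0. Proof. by have [] := (pc_pointed coneP 0).2 erefl. Qed.
Let Peq0 a : P a -> P (- a) -> a = 0.
Proof. by move=> Pa PNa; apply (pc_pointed coneP a). Qed.
Let PJ a p : P p -> P (a^s * p * a). Proof. exact: (pc_conj coneP). Qed.

(** The [x] with [a * b * x = 0] for all [b] form a two-sided ideal, which does
    not contain 1. *)
Lemma prime_ring (a t : A) : a != 0 -> t != 0 -> exists b, a * b * t != 0.
Proof.
case: csaA => regA fieldZ _ _ _ a0 t0; apply: contrapT => h.
have att b : a * b * t = 0.
  by apply/eqP/negPn/negP => abt; apply: h; exists b.
have := @ideal1 _ _ regA fieldZ (fun x => forall b, a * b * x = 0) t.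
move=> /(_ _ _ _ att t0) I1; case/eqP: a0; rewrite -[a]mulr1 -[_ * 1]mulr1.
apply: I1 => [x y hx hy b|x y hy b|x y hx b].
- by rewrite mulrDr hx hy addr0.
- by rewrite mulrA -(mulrA a) hy.
- by rewrite mulrA hx mul0r.
Qed.

Lemma double_eq0 (a : A) : a = - a -> a = 0.
Proof.
move=> /eqP; rewrite -subr_eq0 opprK -mulr2n -scaler_nat scaler_eq0.
by rewrite pnatr_eq0 => /eqP.
Qed.

(** For isotropic [x] and [y], the form defined by [p] takes opposite values at
    [x * a + y * b] and [y * b - x * a]; both are in [P], so they vanish. With
    [c = x^s * p * y] this reads [a^s * c * b = - (b^s * c^s * a)] for all [a]
    and [b]. If [c] were nonzero, this identity would make the algebra
    commutative with trivial involution, while [c^s = - c]. *)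
Lemma isotropic_orthogonal p x y : P p ->
  x^s * p * x = 0 -> y^s * p * y = 0 -> x^s * p * y = 0.
Proof.
move=> Pp xx yy; set c := x^s * p * y.
have cs : y^s * p * x = c^s by rewrite /c !sM sK (Psym Pp) mulrA.
have skew a b : a^s * c * b = - (b^s * c^s * a).
  apply/eqP; rewrite -subr_eq0 opprK; apply/eqP.
  have expand a' b' : (x * a' + y * b')^s * p * (x * a' + y * b') =
      a'^s * c * b' + b'^s * c^s * a'.
    have E z t u v : (z * u)^s * p * (t * v) = u^s * (z^s * p * t) * v.
      by rewrite sM !mulrA.
    by rewrite sD mulrDr !mulrDl !E xx yy cs !mulr0 !mul0r add0r addr0 addrC.
  apply: Peq0; first by rewrite -expand; apply: PJ.
  have -> : - (a^s * c * b + b^s * c^s * a) = (- a)^s * c * b + b^s * c^s * (- a).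
    by rewrite sigmaN !mulNr mulrN opprD.
  by rewrite -expand; apply: PJ.
have c_skew : c = - c^s by have := skew 1 1; rewrite sigma1 !mul1r !mulr1.
have cE a b : a^s * c * b = b^s * c * a.
  by rewrite skew -mulNr -mulrN -c_skew.
have c1 a : c * a = a^s * c by have := cE 1 a; rewrite sigma1 mul1r mulr1.
apply/eqP/negPn/negP => c0.
have cI a : c * a = 0 -> a = 0.
  move=> ca; apply/eqP/negPn/negP => a0; have [d] := prime_ring c0 a0.
  by rewrite c1 -mulrA ca mulr0 eqxx.
have comm (a b : A) : a * b = b * a.
  apply/eqP; rewrite -subr_eq0; apply/eqP/cI.
  by rewrite mulrBr !mulrA c1 (cE a b) c1 subrr.
have sE a : a^s = a.
  by apply/eqP; rewrite -subr_eq0; apply/eqP/cI; rewrite mulrBr (c1 a) comm subrr.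
by case/eqP: c0; apply: double_eq0; rewrite {1}c_skew sE.
Qed.

(** An isotropic [x] with [p * x != 0] would have an isotropic partner [y]
    that is not orthogonal to it, as in the construction of a hyperbolic plane,
    which contradicts [isotropic_orthogonal]. *)
Lemma anisotropic p x : P p -> x^s * p * x = 0 -> p * x = 0.
Proof.
move=> Pp xx; have [w pxw] := (let: And5 regA _ _ _ _ := csaA in regA) (p * x).
(* [g] is idempotent with [g A = p x A]; [y] is [g^s] corrected by a multiple of
   the isotropic [x] in order to become isotropic. *)
set g := p * x * w; have gpx : g * (p * x) = p * x by [].
pose c := - (2%:R^-1 : F) *: (w * p * g^s).
pose y := g^s + x * c.
have pxc : p * x * c = - (2%:R^-1 : F) *: (g * p * g^s).
  by rewrite -scalerAr; congr (_ *: _); rewrite !mulrA.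
have cxp : c^s * x^s * p = (p * x * c)^s by rewrite !sM (Psym Pp) mulrA.
have xpx : c^s * x^s * p * x = 0.
  by rewrite -!mulrA (mulrA _ p) xx mulr0.
have ypx : y^s * p * x = p * x.
  by rewrite /y sD sK sM !mulrDl xpx addr0 -mulrA gpx.
have yy : y^s * p * y = 0.
  have gpg : (g * p * g^s)^s = g * p * g^s.
    by rewrite (sM (g * p)) (sM g) sK (Psym Pp) mulrA.
  rewrite {2}/y mulrDr mulrA ypx pxc /y sD sK sM !mulrDl cxp pxc sigmaZ gpg.
  have gg : g^s * g^s = g^s by rewrite -sM {2}/g mulrA gpx.
  rewrite -scalerAl -(mulrA (g * p)) gg -addrA -scalerDl -opprD.
  have -> : 2%:R^-1 + 2%:R^-1 = 1 :> F.
    by rewrite -mulr2n -[_ *+ 2]mulr_natl mulfV // pnatr_eq0.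
  by rewrite scaleN1r subrr.
by rewrite -ypx; apply: isotropic_orthogonal.
Qed.

(** The codimension of [a A]: the rank of [a], counted downwards. *)
Definition nullity (a : A) : nat := \dim (lker (amull a)).
Arguments nullity a%_R.

Lemma nullity_le a : (nullity a <= m)%N.
Proof. by have [_ _ _ _ <-] := csaA; apply/dimvS/subvf. Qed.

(** If the cone were 0, then both 1 and -1 would be nonnegative for the
    ordering that it induces. *)
Lemma cone_neq0 : exists2 p, P p & p != 0.
Proof.
apply: contrapT => h; have P00 p : P p -> p = 0.
  by move=> Pp; apply/eqP/negPn/negP => p0; apply: h; exists p.
have [_ _ _ /(_ 1) [H _]] := pc_ordering coneP.
suff /eqP : (1 : F) = 0 by rewrite oner_eq0.
by apply: H; split=> p /P00->; rewrite scaler0.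
Qed.

(** The form [u = y^s * t * y] is what makes the reductions below stay in the
    cone: the pseudo-inverse of an element of the cone is in the cone. *)
Lemma sym_pseudo_inverse t : t^s = t ->
  exists u, [/\ u^s = u, t * u * t = t, u * t * u = u & exists y, u = y^s * t * y].
Proof.
have [/(_ t) [y tyt] _ _ _ _] := csaA => ts.
have tyst : t * y^s * t = t by have := congr1 sigma tyt; rewrite !sM ts mulrA.
exists (y^s * t * y); split; last by exists y.
- by rewrite !sM sK ts mulrA.
- by rewrite !mulrA tyst tyt.
- have -> : y^s * t * y * t * (y^s * t * y) = y^s * (t * y * t * y^s * t) * y.
    by rewrite !mulrA.
  by rewrite tyt tyst.
Qed.

(** Gram-Schmidt: [a1 = w^s * a * w], where [w] is the projection onto the
    orthogonal complement of [z] for the form [a]. *)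
Lemma rank_reduction a z (t := z^s * a * z) : P a -> t != 0 ->
  exists a1 x, [/\ P a1, a = a1 + x^s * t * x & (nullity a < nullity a1)%N].
Proof.
move=> Pa t0; have as_ := Psym Pa; have Pt : P t by apply: PJ.
have [u [us tut utu [y uy]]] := sym_pseudo_inverse (Psym Pt).
pose w := 1 - z * u * z^s * a; pose v := a * z * u * z^s * a.
have aw : a * w = a - v by rewrite /w mulrBr mulr1 !mulrA.
exists (a - v), (y * z^s * a); split.
- have -> : a - v = w^s * a * w.
    have -> : w^s = 1 - a * z * u * z^s.
      by rewrite /w sigmaB sigma1 !sM us as_ sK !mulrA.
    rewrite -mulrA aw mulrBl mul1r mulrBr.
    have -> : a * z * u * z^s * v = v.
      have -> : a * z * u * z^s * v = a * z * (u * t * u) * z^s * a.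
        by rewrite /v /t !mulrA.
      by rewrite utu.
    by rewrite -/v subrr subr0.
  exact: PJ.
- by rewrite !sM as_ sK /v uy !mulrA subrK.
- apply: (@ltn_dimv _ _ _ _ (z * u * t)).
  + apply/subvP => x; rewrite !mem_ann_r => /eqP ax.
    by rewrite /v mulrBl -!mulrA ax !mulr0 subrr.
  + rewrite mem_ann_r; apply/eqP.
    have -> : (a - v) * (z * u * t) = a * z * u * t - a * z * (u * t * u) * t.
      by rewrite mulrBl /v /t !mulrA.
    by rewrite utu subrr.
  + rewrite mem_ann_r; apply: contraNneq t0 => h.
    have <- : z^s * (a * (z * u * t)) = t by rewrite -[RHS]tut /t !mulrA.
    by rewrite h mulr0.
Qed.

(** With [u] a pseudo-inverse of [t], the space [t A t] is an algebra with unit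
    [t] for the product [x * u * y]. In it, [t * k * t] generates a commutative
    algebra of symmetric elements, the [N q = t * q(s)] for a polynomial [q]
    and [s = u * (t * k * t)]. Minimality of the rank makes it a domain
    ([N_prime]). As [s] is algebraic, [N] vanishes at a factor
    [(X - a)^2 + b^2]. If [b = 0] then [t * k * t = a *: t]; otherwise
    [r = (s - a) / b] satisfies [r^s * t * r = - t], and [- t] is in [P]. *)
Lemma minimal_rank_scalar p x (t := x^s * p * x) : P p -> t != 0 ->
  (forall y, y^s * p * y != 0 -> (nullity (y^s * p * y) <= nullity t)%N) ->
  forall k, k^s = k -> exists c : F, t * k * t = c *: t.
Proof.
move=> Pp t0 maxt k ks; have Pt : P t by apply: PJ.
have tE : t = x^s * p * x by []. clearbody t.
have ts := Psym Pt; have [u [us tut utu _]] := sym_pseudo_inverse ts.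
pose s := u * (t * k * t); pose H := horner_alg s; pose N q := t * H q.
have tS : t * s = t * k * t by rewrite /s !mulrA tut.
have sS : s^s * t = t * s.
  rewrite tS /s !sM us ks ts.
  have -> : t * (k * t) * u * t = t * k * (t * u * t) by rewrite !mulrA.
  by rewrite tut.
have HS q : (H q)^s * t = t * H q.
  elim/poly_ind: q => [|q c IH]; first by rewrite /H rmorph0 sigma0 mul0r mulr0.
  have -> : H (q * 'X + c%:P) = H q * s + c%:A.
    by rewrite /H rmorphD rmorphM /= horner_algX horner_algC.
  have sH : H q * s = s * H q.
    by rewrite -[s](horner_algX s) -!rmorphM mulrC.
  by rewrite sD sM sA mulrDl mulrDr -mulrA IH mulrA sS -mulrA -sH mulr_algl mulr_algr.
have N_prime q1 q2 : N q1 != 0 -> N (q1 * q2) = 0 -> N q2 = 0.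
  move=> N1 N12; have [a aE] : exists a, a = N q1 by exists (N q1).
  have as_ : a^s = a by rewrite aE /N sM ts HS.
  have tua : t * (u * a) = a by rewrite aE /N !mulrA tut.
  have aua0 : a * u * a != 0.
    apply/negP => /eqP aua; case/eqP: N1; rewrite -aE -tua.
    by apply: anisotropic; rewrite // sM us as_ -mulrA tua.
  have le_aua : (nullity (a * u * a) <= nullity t)%N.
    have E : (x * u * a)^s * p * (x * u * a) = a * u * a.
      have -> : (x * u * a)^s * p * (x * u * a) = a * (u * t * u) * a.
        by rewrite tE !sM us as_ !mulrA.
      by rewrite utu.
    by rewrite -E; apply: maxt; rewrite E.
  have sub : (lker (amull t) <= lker (amull (a * u * a)%R))%VS.
    apply/subvP => z; rewrite !mem_ann_r => /eqP tz.
    by rewrite {2}aE /N -HS -!mulrA tz !mulr0.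
  have /eqP eq_ker : lker (amull t) == lker (amull (a * u * a)) by rewrite eqEdim sub.
  have au2 : a * u * N q2 = 0.
    have -> : a * u * N q2 = (H q1)^s * (t * u * t) * H q2.
      by rewrite aE /N -HS !mulrA.
    by rewrite tut HS -N12 /N /H rmorphM mulrA.
  have : u * N q2 \in lker (amull t).
    rewrite eq_ker mem_ann_r.
    have -> : a * u * a * (u * N q2) = a * u * (a * u * N q2) by rewrite !mulrA.
    by rewrite au2 mulr0.
  by rewrite mem_ann_r => /eqP; rewrite /N !mulrA tut.
have [q q0 Hq] := algebraic_elt s.
have [S qE] := rcf_sqr_factor q.
have NZ c r : N (c%:P * r) = c *: N r.
  by rewrite mul_polyC /N /H linearZ /= mulr_algl scalerAr.
have /eqP : N (q ^+ 2) = 0 by rewrite /N /H expr2 rmorphM /= Hq !mulr0.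
rewrite qE NZ scaler_eq0 expf_eq0 lead_coef_eq0 (negPf q0) /= => /eqP.
elim: S {qE} => [|[a b] S IH].
  by rewrite big_nil /N /H rmorph1 mulr1 => /eqP; rewrite (negPf t0).
rewrite big_cons /=.
have [Nz _|Nz /(N_prime _ _ Nz)/IH //] := eqVneq (N (('X - a%:P) ^+ 2 + (b ^+ 2)%:P)) 0.
have [b0|b0] := eqVneq b 0.
  exists a; have [Na|Na] := eqVneq (N ('X - a%:P)) 0.
    apply/eqP; rewrite -subr_eq0 -tS; apply/eqP; rewrite -[RHS]Na.
    by rewrite /N /H rmorphB /= horner_algX horner_algC mulrBr mulr_algr.
  case/eqP: (Na); apply: N_prime Na _; rewrite -[RHS]Nz b0 expr0n /= addr0.
  by rewrite expr2.
(* Here [r * r + 1] is annihilated, so [H r] is a square root of -1. *)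
pose r := b^-1%:P * ('X - a%:P).
have rE : ('X - a%:P) ^+ 2 + (b ^+ 2)%:P = (b ^+ 2)%:P * (r * r + 1).
  rewrite mulrDr mulr1 -expr2 exprMn mulrA -polyC_exp -polyCM exprVn.
  by rewrite divff ?expf_neq0 // mul1r.
have NtP : P (- t).
  suff -> : - t = (H r)^s * t * H r by apply: PJ.
  have /eqP := Nz; rewrite rE NZ scaler_eq0 expf_eq0 (negPf b0) andbF /=.
  rewrite HS /N /H rmorphD rmorph1 mulrDr mulr1 addr_eq0 => /eqP tE'.
  by rewrite -mulrA -rmorphM tE'.
by case/eqP: t0; apply: Peq0.
Qed.

(** Let [t] be of minimal rank among the nonzero [x0^s * p * x0], and [z = b * t]
    such that [z^s * a * z != 0]. By [minimal_rank_scalar], [z^s * a * z = c *: t];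
    [c] is nonnegative because [P] is pointed, hence a square, and
    [rank_reduction] at [z] removes from [a] a term [x^s * p * x]. *)
Lemma cone_step p : P p -> p != 0 -> forall a, P a -> a != 0 ->
  exists a1 x, [/\ P a1, a = a1 + x^s * p * x & (nullity a < nullity a1)%N].
Proof.
move=> Pp p0 a Pa a0.
pose Q n := `[< exists2 y, y^s * p * y != 0 & nullity (y^s * p * y) = n >].
have exQ : exists n, Q n.
  by exists (nullity p); apply/asboolP; exists 1; rewrite sigma1 mul1r mulr1.
have leQ n : Q n -> (n <= m)%N by move=> /asboolP[y _ <-]; apply: nullity_le.
have [n /asboolP[x0 t0 tn] maxt] := ex_maxnP exQ leQ.
set t := x0^s * p * x0 in t0 tn.
have [b abt] := prime_ring a0 t0.
have Pt : P t by apply: PJ.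
have as_ := Psym Pa; have ts := Psym Pt.
pose z := b * t; have t'0 : z^s * a * z != 0.
  by apply: contraNneq abt => /(anisotropic Pa); rewrite /z mulrA => ->.
have [a1 [x [Pa1 aE lt_a]]] := rank_reduction Pa t'0.
have zE : z^s * a * z = t * (b^s * a * b) * t by rewrite /z sM ts !mulrA.
have [c cE] : exists c : F, t * (b^s * a * b) * t = c *: t.
  apply: (minimal_rank_scalar Pp t0); last by rewrite !sM as_ sK mulrA.
  by move=> y y0; rewrite -/t tn; apply: maxt; apply/asboolP; exists y.
have sqrtE d : 0 <= d -> (Num.sqrt d *: x0)^s * p * (Num.sqrt d *: x0) = d *: t.
  move=> d0; rewrite sigmaZ -!scalerAl -scalerAr scalerA -expr2 sqr_sqrtr //.
have c0 : 0 <= c.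
  rewrite leNgt; apply/negP => c0; case/eqP: t'0; apply: Peq0; first exact: PJ.
  by rewrite zE cE -scaleNr -sqrtE ?oppr_ge0 ?ltW //; apply: PJ.
exists a1, (Num.sqrt c *: x0 * x); split=> //; rewrite {1}aE zE cE -sqrtE //.
by rewrite sM !mulrA.
Qed.

(** Each step of [cone_step] increases the nullity, which is at most [m]; this
    bounds the number of terms. *)
Theorem cone_generated p : P p -> p != 0 -> forall a,
  P a <-> exists x : 'I_m -> A, a = \sum_l (x l)^s * p * x l.
Proof.
move=> Pp p0 a; split=> [|[x ->]]; last first.
  by apply: (big_ind P) => [|u v|l _]; [exact: P0|exact: (pc_add coneP)|exact: PJ].
suff H n b : P b -> (m <= n + nullity b)%N ->
    exists x : 'I_n -> A, b = \sum_l (x l)^s * p * x l.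
  by move=> Pa; apply: H; rewrite // leq_addr.
elim: n b => [|n IH] b Pb le_m.
  exists (fun=> 0); rewrite big_ord0.
  have /eqP kerb : lker (amull b) == fullv.
    by rewrite eqEdim subvf; have [_ _ _ _ ->] := csaA.
  have : 1 \in lker (amull b) by rewrite kerb memvf.
  by rewrite mem_ann_r mulr1 => /eqP.
have [->|b0] := eqVneq b 0.
  by exists (fun=> 0); rewrite big1 // => l _; rewrite mulr0.
have [b1 [x [Pb1 bE lt_b]]] := cone_step Pp p0 Pb b0.
have [|y b1E] := IH b1 Pb1.
  by apply: leq_trans le_m _; rewrite addSnnS leq_add2l.
exists (scons x y); rewrite big_ord_recl {1}bE b1E addrC /scons unlift_none.
by congr (_ + _); apply: eq_bigr => l _; rewrite liftK.
Qed.

(** Simplicity with a bound on the number of terms: the ideal generated by [y]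
    consists of the [\sum_l e l * y * w l]. *)
Lemma basis_spread (e : 'I_m -> A) :
  (forall a, exists k : 'I_m -> F, a = \sum_i k i *: e i) ->
  forall y, y != 0 -> exists w : 'I_m -> A, 1 = \sum_l e l * y * w l.
Proof.
have [regA fieldZ _ _ _] := csaA => span y y0.
pose I (x : A) := exists w : 'I_m -> A, x = \sum_l e l * y * w l.
apply: (@ideal1 _ _ regA fieldZ I y _ _ _ _ y0).
- move=> _ _ [v ->] [w ->]; exists (fun l => v l + w l).
  by rewrite -big_split; apply: eq_bigr => l _; rewrite mulrDr.
- move=> a _ [w ->].
  have [k kE] := choice (fun l => span (a * e l)).
  exists (fun i => \sum_l k l i *: w l).
  rewrite mulr_sumr; under eq_bigr do rewrite !mulrA kE !mulr_suml.
  rewrite exchange_big; apply: eq_bigr => i _; rewrite mulr_sumr.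
  by apply: eq_bigr => l _; rewrite -!scalerAl scalerAr.
- move=> _ b [w ->]; exists (fun l => w l * b).
  by rewrite mulr_suml; apply: eq_bigr => l _; rewrite mulrA.
have [k k1] := span 1; exists (fun l => (k l)%:A).
rewrite -[LHS]mul1r {1}k1 mulr_suml; apply: eq_bigr => l _.
by rewrite mulr_algr scalerAl.
Qed.

End Cones.

(** * The reduced trace is linear over the base field *)

(** The reduced trace is a composite of maps that are linear over the centre,
    up to the injection of the centre into the splitting field. *)
Lemma reduced_trace_linear (F : fieldType) (A : falgType F) (m : nat)
    (sigma Trd : A -> A) :
  csa_with_involution m sigma -> reduced_trace Trd ->
  forall k a b, Trd (k *: a + b) = k *: Trd a + Trd b.
Proof.
move=> [_ fieldZ _ _ _] [E [iota [B [j [r [f [[jZ _] _ TrdE]]]]]]] k a b.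
have id1 : algid 'Z({:A})%AS = 1 :> A.
  by apply/eqP; rewrite algid_eq1 mem_centre // => x; rewrite mul1r mulr1.
have val1 : vsval (1 : centre A) = 1 by rewrite -id1.
have iotaI (z : centre A) : iota z = 0 -> z = 0.
  move=> iz; apply/eqP/negPn/negP => z0.
  have vz0 : vsval z != 0 by rewrite (inj_eq val_inj z 0).
  have [w wZ zw] := fieldZ _ (subvsP z) vz0.
  have : z * Subvs wZ = 1 by apply: val_inj; apply: (etrans zw); exact: (esym val1).
  by move/(congr1 iota)/eqP; rewrite rmorphM iz mul0r rmorph1 eq_sym oner_eq0.
have [t -> tE] := TrdE (k *: a + b); have [u -> uE] := TrdE a; have [v -> vE] := TrdE b.
pose z : centre A := k%:A.
have valz : vsval z = k%:A by rewrite linearZ /= id1.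
have -> : t = z * u + v.
  apply/eqP; rewrite -subr_eq0; apply/eqP/iotaI.
  rewrite rmorphB rmorphD rmorphM tE uE vE.
  have -> : k *: a + b = vsval z * a + b by rewrite valz mulr_algl.
  by rewrite rmorphD jZ linearD linearZ /= linearD linearZ /= subrr.
have -> : vsval (z * u + v) = vsval z * vsval u + vsval v by [].
by rewrite valz mulr_algl.
Qed.

(** * Formulas preserved by embeddings *)

Section FirstOrder.
Variable L : language.

Lemma comp_scons (S T : Type) (h : S -> T) n x (v : 'I_n -> S) :
  h \o scons x v = scons (h x) (h \o v).
Proof. by apply/funext => i; rewrite /scons /=; case: unlift. Qed.

Lemma eval_embedding (M N : structure L) (h : M -> N) : embedding h ->
  forall n (v : 'I_n -> M) (t : term L n), h (eval v t) = eval (h \o v) t.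
Proof.
move=> [_ hf _] n v; elim=> [//|f a IH] /=; rewrite hf; congr finterp.
by apply/funext => i; apply: IH.
Qed.

Lemma isomorphism_elementary (M N : structure L) (h : M -> N) :
  embedding h -> (forall y, exists x, h x = y) -> elementary h.
Proof.
move=> hh hs n p; have [hI _ hr] := hh.
elim: p => {n} [n|n t u|n r a|n p IHp q IHq|n p IHp] v //=.
- rewrite -!eval_embedding //; split=> [->//|]; exact: hI.
- rewrite hr; suff -> : h \o (fun i => eval v (a i)) = fun i => eval (h \o v) (a i) by [].
  by apply/funext => i; apply: eval_embedding.
- by rewrite IHp IHq.
split=> Mp x; last by rewrite IHp comp_scons.
by have [y <-] := hs x; rewrite -comp_scons -IHp.
Qed.

(** Existential formulas are defined by what they are used for, which avoids a
    syntactic class closed under conjunction, disjunction and quantification. *)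
Definition preserved n (p : formula L n) : Prop :=
  forall (M N : structure L) (h : M -> N), embedding h ->
  forall v, sat M p v -> sat N p (h \o v).

Fixpoint closure n : formula L n -> sentence L :=
  if n is n'.+1 then fun p => closure (All p) else id.

Lemma holds_closure (M : structure L) n (p : formula L n) :
  holds M (closure p) <-> forall v, sat M p v.
Proof.
elim: n p => [|n IH] p //=; rewrite IH; split=> Mp v; last by move=> x; apply: Mp.
suff -> : v = scons (v ord0) (v \o lift ord0) by apply: Mp.
by apply/funext => i; rewrite /scons; case: unliftP => [j|] ->.
Qed.

(** A model [M] of the theory of [K] need not be in [K]. It satisfies, however,
    the universal closure of the equivalence of [p] with its preserved form
    [q]; so truth of [p] goes up along embeddings between models. The same for
    the negation of [p] gives the converse. *)
Lemma model_complete_preserved (K : structure L -> Prop) :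
  (forall n (p : formula L n), exists2 q : formula L n, preserved q &
     forall M, K M -> forall v, sat M q v <-> sat M p v) ->
  model_complete (theory_of K).
Proof.
move=> pres.
have transfer M n (p q : formula L n) : is_model (theory_of K) M ->
    (forall S, K S -> forall v, sat S q v <-> sat S p v) ->
    forall v, sat M q v <-> sat M p v.
  move=> MK pq v; have : holds M (closure (Imp q p)).
    by apply: MK => S /pq E; apply/holds_closure => w /=; rewrite E.
  have : holds M (closure (Imp p q)).
    by apply: MK => S /pq E; apply/holds_closure => w /=; rewrite E.
  by move=> /holds_closure/(_ v) h1 /holds_closure/(_ v) h2.
move=> M N MK NK h hh n p v.
have up (p' : formula L n) : sat M p' v -> sat N p' (h \o v).
  have [q qq qE] := pres n p'.
  by rewrite -(transfer M _ _ _ MK qE) -(transfer N _ _ _ NK qE); apply: qq.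
split=> [|Np]; first exact: up.
by apply: contrapT => nMp; apply: (up (Imp p (Bot L n))).
Qed.

End FirstOrder.

(** * Classes of definable families of relations *)

Definition ocons (T I : Type) (x : T) (v : I -> T) : option I -> T :=
  fun o => if o is Some i then v i else x.

Definition sumv (T I J : Type) (v : I -> T) (w : J -> T) : I + J -> T :=
  fun s => match s with inl i => v i | inr j => w j end.

Section Definability.
Variables (K : Type) (T : K -> Type).

(** A relation on [T M], with arguments indexed by [I], for every [M] at once.
    Below, [M] ranges over the real closed fields, or over the algebras with a
    cone. Arbitrary index types avoid computing with variable numbers. *)
Definition relfamily (I : Type) : Type := forall M : K, (I -> T M) -> Prop.

(** The closure properties shared by semialgebraic and existential families. *)
Record defclass (D : forall I : Type, relfamily I -> Prop) : Prop := DefClass {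
  def_rename : forall I J (f : I -> J) X,
    D I X -> D J (fun M v => X M (v \o f));
  def_true : forall I, D I (fun _ _ => True);
  def_and : forall I X Y, D I X -> D I Y -> D I (fun M v => X M v /\ Y M v);
  def_ex1 : forall I X, D (option I) X ->
    D I (fun M v => exists x, X M (ocons x v)) }.

Variable D : forall I : Type, relfamily I -> Prop.
Hypothesis DC : defclass D.

Lemma def_ext I (X Y : relfamily I) : (forall M v, X M v <-> Y M v) -> D X -> D Y.
Proof.
move=> XY; suff -> : X = Y by [].
apply: functional_extensionality_dep => M.
by apply/funext => v; apply/propext.
Qed.

Lemma def_forall_fin (J : finType) I (X : J -> relfamily I) :
  (forall j, D (X j)) -> D (fun M v => forall j, X j M v).
Proof.
move=> DX; suff H (s : seq J) : D (fun M v => forall j, j \in s -> X j M v).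
  apply: def_ext (H (enum J)) => M v; split=> h j; last by move=> _; apply: h.
  by apply: h; rewrite mem_enum.
elim: s => [|j s IH]; first by apply: def_ext (def_true DC I).
apply: def_ext (def_and DC (DX j) IH) => M v; split=> [[Xj Xs] i|h].
  by rewrite inE => /predU1P[->|/Xs].
by split=> [|i si]; apply: h; rewrite inE ?eqxx ?si ?orbT.
Qed.

Lemma def_ex (J : finType) I (X : relfamily (I + J)) :
  D X -> D (fun M v => exists w : J -> T M, X M (sumv v w)).
Proof.
move=> DX; suff H n (Y : relfamily (I + 'I_n)) :
    D Y -> D (fun M v => exists w : 'I_n -> T M, Y M (sumv v w)).
  pose f (s : I + J) : I + 'I_#|J| :=
    match s with inl i => inl i | inr j => inr (enum_rank j) end.
  apply: def_ext (H _ _ (def_rename DC f DX)) => M v; split=> -[w Xw].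
    exists (w \o enum_rank); suff <- : sumv v w \o f = sumv v (w \o enum_rank) by [].
    by apply/funext => -[].
  exists (w \o enum_val); suff -> : sumv v (w \o enum_val) \o f = sumv v w by [].
  by apply/funext => -[i|j] //=; rewrite enum_rankK.
elim: n Y => [|n IH] Y DY.
  pose f (s : I + 'I_0) : I :=
    match s with inl i => i | inr (Ordinal _ lt0) => False_rect I (notF lt0) end.
  have fE M (v : I -> T M) w : v \o f = sumv v w by apply/funext => -[|[]].
  apply: def_ext (def_rename DC f DY) => M v; split=> [Yv|[w]].
    have w (i : 'I_0) : T M by case: i.
    by exists w; rewrite -(fE _ v w).
  by rewrite -fE.
pose f (s : I + 'I_n.+1) : option (I + 'I_n) :=
  match s with
  | inl i => Some (inl i)
  | inr j => omap inr (unlift ord0 j)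
  end.
apply: def_ext (IH _ (def_ex1 DC (def_rename DC f DY))) => M v.
split=> [[w [x Yw]]|[w Yw]].
  exists (scons x w); suff <- : ocons x (sumv v w) \o f = sumv v (scons x w) by [].
  by apply/funext => -[i|j] //=; rewrite /scons; case: unliftP.
exists (w \o lift ord0), (w ord0).
suff -> : ocons (w ord0) (sumv v (w \o lift ord0)) \o f = sumv v w by [].
by apply/funext => -[i|j] //=; case: unliftP => [k|] ->.
Qed.

End Definability.

(** * Semialgebraic families *)

Definition field_family (I : Type) : Type := relfamily (fun R : rcfType => R : Type) I.

(** Uniformity is in the order of quantifiers: the formula [p] comes before the
    field. The place [g i] of the variable [i] is arbitrary, which makes
    renaming immediate; the bound [b] provides a fresh variable for
    quantification. *)
Definition semialg (I : Type) (Y : field_family I) : Prop :=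
  forall (g : I -> nat) (b : nat), (forall i, g i < b)%N ->
  exists p : qe_rcf.formula rat, forall (R : rcfType) (e : seq R),
    feval e p <-> Y R (fun i => e`_(g i)).

Definition upoly (I : Type) (X : forall R : rcfType, (I -> R) -> R) : Prop :=
  forall g : I -> nat, exists t : qe_rcf.term rat,
  forall (R : rcfType) (e : seq R), teval e t = X R (fun i => e`_(g i)).

Lemma semialgP : defclass semialg.
Proof.
split=> [I J f X DX g b gb|I g b _|I X Y DX DY g b gb|I X DX g b gb].
- by have [p pE] := DX (g \o f) b (fun i => gb (f i)); exists p.
- by exists (qe_rcf.Bool true).
- have [p pE] := DX g b gb; have [q qE] := DY g b gb.
  exists (qe_rcf.And p q) => R e; rewrite /feval /=.
  by split=> [/andP[/pE ? /qE]|[/pE ? /qE ?]]; [split|apply/andP].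
(* [b] is a variable distinct from all the [g i]. *)
pose g' o := if o is Some i then g i else b.
have [|p pE] := DX g' b.+1; first by case=> [i|] //=; rewrite ltnS ltnW.
have [q qE] := qf_exists p b; exists q => R e; rewrite qE.
have E x : ocons x (fun i => e`_(g i)) = fun o => (set_nth 0 e b x)`_(g' o).
  by apply/funext => -[i|]; rewrite nth_set_nth /= ?eqxx // ltn_eqF.
by split=> -[x Hx]; exists x; [rewrite E; apply/pE|apply/pE; rewrite -E].
Qed.

Lemma semialg_not I (X : field_family I) : semialg X -> semialg (fun R v => ~ X R v).
Proof.
move=> DX g b gb; have [p pE] := DX g b gb; exists (qe_rcf.Not p) => R e.
by rewrite /feval /=; split=> [/negP np /pE|nX]; [|apply/negP => /pE].
Qed.

Lemma semialg_imp I (X Y : field_family I) :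
  semialg X -> semialg Y -> semialg (fun R v => X R v -> Y R v).
Proof.
move=> DX DY; have := semialg_not (def_and semialgP DX (semialg_not DY)).
apply: def_ext => R v; split=> [h Xv|h [/h]//].
by apply: contrapT => nY; apply: h.
Qed.

Lemma semialg_all (J : finType) I (X : field_family (I + J)) :
  semialg X -> semialg (fun R v => forall w : J -> R, X R (sumv v w)).
Proof.
move=> /semialg_not/(def_ex semialgP)/semialg_not; apply: def_ext => R v.
by split=> [h w|h [w]]; [apply: contrapT => nX; apply: h; exists w|].
Qed.

Lemma semialg_eq I (X Y : forall R : rcfType, (I -> R) -> R) :
  upoly X -> upoly Y -> semialg (fun R v => X R v = Y R v).
Proof.
move=> PX PY g b _; have [t tE] := PX g; have [u uE] := PY g.
exists (qe_rcf.Equal t u) => R e; rewrite -tE -uE /feval /=.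
by split=> [/eqP|/eqP].
Qed.

Lemma upoly_var I (i : I) : upoly (fun R v => v i).
Proof. by move=> g; exists (qe_rcf.Var _ (g i)). Qed.

Lemma upoly0 I : upoly (fun R (v : I -> R) => 0).
Proof. by move=> g; exists (qe_rcf.NatConst _ 0). Qed.

Lemma upolyD I (X Y : forall R : rcfType, (I -> R) -> R) :
  upoly X -> upoly Y -> upoly (fun R v => X R v + Y R v).
Proof.
move=> PX PY g; have [t tE] := PX g; have [u uE] := PY g.
by exists (qe_rcf.Add t u) => R e; rewrite -tE -uE.
Qed.

Lemma upolyM I (X Y : forall R : rcfType, (I -> R) -> R) :
  upoly X -> upoly Y -> upoly (fun R v => X R v * Y R v).
Proof.
move=> PX PY g; have [t tE] := PX g; have [u uE] := PY g.
by exists (qe_rcf.Mul t u) => R e; rewrite -tE -uE.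
Qed.

Lemma upolyN I (X : forall R : rcfType, (I -> R) -> R) :
  upoly X -> upoly (fun R v => - X R v).
Proof.
by move=> PX g; have [t tE] := PX g; exists (qe_rcf.Opp t) => R e; rewrite -tE.
Qed.

Lemma upoly_sum (J : finType) I (X : J -> forall R : rcfType, (I -> R) -> R) :
  (forall j, upoly (X j)) -> upoly (fun R v => \sum_j X j R v).
Proof.
move=> PX; elim: (index_enum J) => [|j s IH] g.
  by have [t tE] := upoly0 g; exists t => R e; rewrite big_nil tE.
by have [t tE] := upolyD (PX j) IH g; exists t => R e; rewrite big_cons tE.
Qed.

(** * Algebras in coordinates *)

Section Interpretation.
Variable m : nat.
Notation L := L_CSA_I_P_Trd.

(** Names for the scalars that describe an algebra in coordinates: structure
    constants, matrices of the involution and of the trace, coordinates of the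
    unit and of a generator of the cone. *)
Definition param : finType :=
  ('I_m * 'I_m * 'I_m + 'I_m * 'I_m + 'I_m * 'I_m + 'I_m + 'I_m)%type.
Definition Pmul (i j k : 'I_m) : param := inl (inl (inl (inl (i, j, k)))).
Definition Psig (i j : 'I_m) : param := inl (inl (inl (inr (i, j)))).
Definition Ptrd (i j : 'I_m) : param := inl (inl (inr (i, j))).
Definition Pone (i : 'I_m) : param := inl (inr i).
Definition Pcone (i : 'I_m) : param := inr i.

Section Structure.
Variables (R : rcfType) (d : param -> R).
Implicit Types a b : 'I_m -> R.

Definition smul a b : 'I_m -> R :=
  fun k => \sum_i \sum_j a i * b j * d (Pmul i j k).
Definition ssig a : 'I_m -> R := fun k => \sum_i a i * d (Psig i k).
Definition strd a : 'I_m -> R := fun k => \sum_i a i * d (Ptrd i k).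
(** The sum of m terms sigma(x) p x, see [cone_generated]. *)
Definition scone (x : 'I_m * 'I_m -> R) : 'I_m -> R := fun k =>
  \sum_l smul (smul (ssig (fun i => x (l, i))) (d \o Pcone))
               (fun i => x (l, i)) k.

Definition sfun (f : csa_fsym) : ('I_(csa_farity f) -> ('I_m -> R)) -> ('I_m -> R) :=
  match f return ('I_(csa_farity f) -> ('I_m -> R)) -> ('I_m -> R) with
  | csa_zero => fun _ _ => 0
  | csa_one => fun _ => d \o Pone
  | csa_add => fun u k => u ord0 k + u ord_max k
  | csa_opp => fun u k => - u ord0 k
  | csa_mul => fun u => smul (u ord0) (u ord_max)
  | csa_sigma => fun u => ssig (u ord0)
  end.

(** The algebra on R^m with parameters [d]. It makes sense for all [d], whether
    or not the operations are those of an algebra, so that satisfaction in it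
    can be studied as a condition on [d]. *)
Definition sstruct : structure L :=
  @expand_fun L_CSA_I_P 1
    (@expand_rel L_CSA_I 1
      (@Structure L_CSA_I ('I_m -> R) sfun
        (fun _ u => exists c : unit -> R, u ord0 = fun k => c tt * d (Pone k)))
      (fun u => exists x, u ord0 = scone x))
    (fun u => strd (u ord0)).

(** The bounded form of simplicity given by [basis_spread]. *)
Definition ssimple : Prop := forall y : 'I_m -> R, y <> (fun=> 0) ->
  exists z w : 'I_m * 'I_m -> R, d \o Pone =
    fun k => \sum_l smul (smul (fun i => z (l, i)) y) (fun i => w (l, i)) k.

End Structure.

Definition upolys I (X : forall R : rcfType, (I -> R) -> ('I_m -> R)) : Prop :=
  forall k, upoly (fun R v => X R v k).

Section RVec.
Variables (I : Type) (dd : param -> I).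
Implicit Types X Y : forall R : rcfType, (I -> R) -> ('I_m -> R).

Lemma upolys_smul X Y : upolys X -> upolys Y ->
  upolys (fun R v => smul (v \o dd) (X R v) (Y R v)).
Proof.
move=> VX VY k; apply: upoly_sum => i; apply: upoly_sum => j.
by apply: upolyM; [apply: upolyM|apply: upoly_var].
Qed.

Lemma upolys_ssig X : upolys X -> upolys (fun R v => ssig (v \o dd) (X R v)).
Proof. by move=> VX k; apply: upoly_sum => i; apply: upolyM; [|apply: upoly_var]. Qed.

Lemma upolys_strd X : upolys X -> upolys (fun R v => strd (v \o dd) (X R v)).
Proof. by move=> VX k; apply: upoly_sum => i; apply: upolyM; [|apply: upoly_var]. Qed.

Lemma upolys_var (f : 'I_m -> I) : upolys (fun R v => v \o f).
Proof. by move=> k; apply: upoly_var. Qed.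

Lemma semialg_veq X Y : upolys X -> upolys Y -> semialg (fun R v => X R v = Y R v).
Proof.
move=> VX VY; have := def_forall_fin semialgP (fun k => semialg_eq (VX k) (VY k)).
by apply: def_ext => R v; split=> [h|-> //]; apply/funext.
Qed.

(** The coordinates of the value of a term are polynomials in the coordinates of
    the variables and in the parameters. *)
Lemma upolys_eval n (xi : 'I_n -> 'I_m -> I) (t : term L n) :
  upolys (fun R v => @eval L (sstruct (v \o dd)) n (fun i => v \o xi i) t).
Proof.
elim: t => [i|[f|] a IH] /=; first exact: upolys_var.
  case: f a IH => a IH /=.
  - by move=> k; apply: upoly0.
  - exact: upolys_var.
  - by move=> k; apply: upolyD; apply: IH.
  - by move=> k; apply: upolyN; apply: IH.
  - by apply: upolys_smul; apply: IH.
  - by apply: upolys_ssig; apply: IH.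
by apply: upolys_strd; apply: IH.
Qed.

End RVec.

(** The interpretation of the algebra in the field: a variable of the algebra is
    replaced by [m] variables of the field. Only the base field, the cone and
    the quantifiers need quantification over the field. *)
Lemma semialg_sat n (p : formula L n) I (dd : param -> I) (xi : 'I_n -> 'I_m -> I) :
  semialg (fun R v => @sat L (sstruct (v \o dd)) n p (fun i => v \o xi i)).
Proof.
elim: p I dd xi => {n} [n|n t u|n [[]|] a|n p IHp q IHq|n p IHp] I dd xi /=.
- apply: def_ext (semialg_not (def_true semialgP I)) => R v.
  by split=> // /(_ Logic.I).
- by apply: semialg_veq; apply: upolys_eval.
- apply: (def_ex semialgP (J := unit) (X := fun R v =>
    @eval L (sstruct (v \o (inl \o dd))) n (fun i => v \o (inl \o xi i)) (a ord0) =
    fun k => v (inr tt) * v (inl (dd (Pone k))))).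
  apply: semialg_veq; first exact: (upolys_eval (inl \o dd) (fun i => inl \o xi i)).
  by move=> k; apply: upolyM; apply: upoly_var.
- apply: (def_ex semialgP (J := ('I_m * 'I_m)%type) (X := fun R v =>
    @eval L (sstruct (v \o (inl \o dd))) n (fun i => v \o (inl \o xi i)) (a ord0) =
    scone (v \o (inl \o dd)) (v \o inr))).
  apply: semialg_veq; first exact: (upolys_eval (inl \o dd) (fun i => inl \o xi i)).
  move=> k; apply: upoly_sum => l; apply: upolys_smul; last by move=> ?; apply: upoly_var.
  apply: upolys_smul; last exact: upolys_var.
  by apply: upolys_ssig => ?; apply: upoly_var.
- exact: semialg_imp.
- have := semialg_all (IHp _ (inl \o dd) (scons inr (fun i => inl \o xi i))).
  apply: def_ext => R v; split=> h x.
    have := h x; congr (sat _ _); apply/funext => i; rewrite /scons.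
    by case: (unlift ord0 i).
  have := h x; congr (sat _ _); apply/funext => i; rewrite /scons.
  by case: (unlift ord0 i).
Qed.

Lemma semialg_ssimple I (dd : param -> I) : semialg (fun R v => ssimple (v \o dd)).
Proof.
pose J := (I + 'I_m + ('I_m * 'I_m) + ('I_m * 'I_m))%type.
pose dd' (p : param) : J := inl (inl (inl (dd p))).
have D : semialg (fun R (v : J -> R) => v \o dd' \o Pone = fun k => \sum_l
    smul (v \o dd') (smul (v \o dd') (fun i => v (inl (inr (l, i))))
                                     (fun i => v (inl (inl (inr i)))))
         (fun i => v (inr (l, i))) k).
  apply: semialg_veq => k; first exact: upoly_var.
  apply: upoly_sum => l; apply: upolys_smul; last exact: upolys_var.
  by apply: upolys_smul; apply: upolys_var.
have D0 : semialg (fun R (v : I + 'I_m -> R) => v \o inr = fun=> 0).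
  by apply: semialg_veq => k; [apply: upoly_var|apply: upoly0].
exact: semialg_all (semialg_imp (semialg_not D0) (def_ex semialgP (def_ex semialgP D))).
Qed.

(** * Existential definability in algebras with a cone *)

(** [trd] is any F-linear map, so that one argument serves the reduced trace and
    the identity. *)
Record amodel := AModel {
  base : rcfType;
  alg : falgType base;
  inv : alg -> alg;
  cone : set alg;
  trd : alg -> alg;
  amodel_csa : csa_with_involution m inv;
  amodel_cone : prepositive_cone inv cone;
  amodel_trd : forall k a b, trd (k *: a + b) = k *: trd a + trd b }.

Definition str (M : amodel) : structure L :=
  ocsa_trd_structure (@inv M) (@cone M) (@trd M).

Definition alg_family (I : Type) : Type := relfamily (fun M : amodel => alg M : Type) I.

(** The family is defined, in all the algebras considered, by one formula that
    is preserved by embeddings of arbitrary structures. *)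
Definition exdef (I : Type) (X : alg_family I) : Prop :=
  forall n (g : I -> 'I_n), exists2 p : formula L n, preserved p &
  forall (M : amodel) (v : 'I_n -> alg M), sat (str M) p v <-> X M (v \o g).

Definition aterm (I : Type) (X : forall M : amodel, (I -> alg M) -> alg M) : Prop :=
  forall n (g : I -> 'I_n), exists t : term L n,
  forall (M : amodel) (v : 'I_n -> alg M), @eval L (str M) n v t = X M (v \o g).

Lemma exdefP : defclass exdef.
Proof.
split=> [I J f X DX n g|I n g|I X Y DX DY n g|I X DX n g].
- by have [p pp pE] := DX n (g \o f); exists p.
- by exists (Imp (Bot L n) (Bot L n)) => [M N h hh v _ []|M v]; split=> // _ [].
- have [p pp pE] := DX n g; have [q qq qE] := DY n g.
  exists (Imp (Imp p (Imp q (Bot L n))) (Bot L n)).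
    move=> M N h hh v /= pq pq'; apply: pq => Mp Mq; apply: pq'.
      exact: pp Mp.
    exact: qq Mq.
  move=> M v /=; rewrite -pE -qE; split=> [h|[Mp Mq] h]; last exact: h.
  by apply: contrapT => npq; apply: h => Mp Mq; apply: npq.
have [p pp pE] := DX n.+1 (fun o => if o is Some i then lift ord0 (g i) else ord0).
exists (Imp (All (Imp p (Bot L _))) (Bot L n)).
  move=> M N h hh v /= ex nex; apply: ex => x Mp; apply: (nex (h x)).
  by rewrite -comp_scons; apply: pp.
move=> M v /=.
have E x : scons x v \o (fun o => if o is Some i then lift ord0 (g i) else ord0) =
           ocons x (v \o g).
  by apply/funext => -[i|]; rewrite /= /scons ?liftK ?unlift_none.
split=> [h|[x Xx] h]; last by apply: (h x); apply/pE; rewrite E.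
apply: contrapT => nX; apply: h => x /pE; rewrite E => Xx.
by apply: nX; exists x.
Qed.

Lemma exdef_or I (X Y : alg_family I) :
  exdef X -> exdef Y -> exdef (fun M v => X M v \/ Y M v).
Proof.
move=> DX DY n g; have [p pp pE] := DX n g; have [q qq qE] := DY n g.
exists (Imp (Imp p (Bot L n)) q).
  move=> M N h hh v /= pq np; apply: qq (pq _) => // Mp; apply: np.
  exact: pp Mp.
move=> M v /=; rewrite -pE -qE; split=> [h|[Mp /(_ Mp)|//] //].
by have [?|/h ?] := EM (sat (str M) p v); [left|right].
Qed.

Lemma exdef_false I : exdef (fun M (v : I -> alg M) => False).
Proof. by move=> n g; exists (Bot L n). Qed.

Lemma exdef_eq I (X Y : forall M, (I -> alg M) -> alg M) :
  aterm X -> aterm Y -> exdef (fun M v => X M v = Y M v).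
Proof.
move=> TX TY n g; have [t tE] := TX n g; have [u uE] := TY n g.
exists (Eq t u) => [M N h hh v /= tu|M v /=]; last by rewrite tE uE.
by rewrite -!eval_embedding // tu.
Qed.

Lemma exdef_base I (X : forall M, (I -> alg M) -> alg M) :
  aterm X -> exdef (fun M v => base_field (X M v)).
Proof.
move=> TX n g; have [t tE] := TX n g.
exists (@Rel L n (Some tt) (fun _ => t)) => [M N h hh v /=|M v /=]; last by rewrite tE.
case: (hh) => _ _ hr /hr; congr rinterp; apply/funext => i /=.
exact: eval_embedding.
Qed.

Lemma exdef_cone I (X : forall M, (I -> alg M) -> alg M) :
  aterm X -> exdef (fun M v => cone (X M v)).
Proof.
move=> TX n g; have [t tE] := TX n g.
exists (@Rel L n None (fun _ => t)) => [M N h hh v /=|M v /=]; last by rewrite tE.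
case: (hh) => _ _ hr /hr; congr rinterp; apply/funext => i /=.
exact: eval_embedding.
Qed.

Lemma aterm_var I (i : I) : aterm (fun M v => v i).
Proof. by move=> n g; exists (Var L (g i)). Qed.

Lemma aterm_app0 I (f : csa_fsym) (Ef : csa_farity f = 0%N)
    (X : forall M, (I -> alg M) -> alg M) :
  (forall M v a, finterp (str M) (Some f) a = X M v) -> aterm X.
Proof.
move=> XE n g; have a : 'I_(csa_farity f) -> term L n by rewrite Ef => -[].
by exists (@App L n (Some f) a) => M v /=; apply: XE.
Qed.

Lemma aterm0 I : aterm (fun M (v : I -> alg M) => 0).
Proof. exact: (@aterm_app0 _ csa_zero). Qed.

Lemma aterm1 I : aterm (fun M (v : I -> alg M) => 1).
Proof. exact: (@aterm_app0 _ csa_one). Qed.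

Section ATerm.
Variable I : Type.
Implicit Types X Y : forall M, (I -> alg M) -> alg M.

Lemma atermN X : aterm X -> aterm (fun M v => - X M v).
Proof.
move=> TX n g; have [t tE] := TX n g.
by exists (@App L n (Some csa_opp) (fun _ => t)) => M v /=; rewrite tE.
Qed.

Lemma aterm_inv X : aterm X -> aterm (fun M v => inv (X M v)).
Proof.
move=> TX n g; have [t tE] := TX n g.
by exists (@App L n (Some csa_sigma) (fun _ => t)) => M v /=; rewrite tE.
Qed.

Lemma aterm_trd X : aterm X -> aterm (fun M v => trd (X M v)).
Proof.
move=> TX n g; have [t tE] := TX n g.
by exists (@App L n None (fun _ => t)) => M v /=; rewrite tE.
Qed.

Lemma atermD X Y : aterm X -> aterm Y -> aterm (fun M v => X M v + Y M v).
Proof.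
move=> TX TY n g; have [t tE] := TX n g; have [u uE] := TY n g.
exists (@App L n (Some csa_add) (fun i => if i == ord0 then t else u)) => M v /=.
by rewrite tE uE.
Qed.

Lemma atermM X Y : aterm X -> aterm Y -> aterm (fun M v => X M v * Y M v).
Proof.
move=> TX TY n g; have [t tE] := TX n g; have [u uE] := TY n g.
exists (@App L n (Some csa_mul) (fun i => if i == ord0 then t else u)) => M v /=.
by rewrite tE uE.
Qed.

End ATerm.

Lemma aterm_sum (J : finType) I (X : J -> forall M, (I -> alg M) -> alg M) :
  (forall j, aterm (X j)) -> aterm (fun M v => \sum_j X j M v).
Proof.
move=> TX; elim: (index_enum J) => [|j s IH] n g.
  by have [t tE] := aterm0 g; exists t => M v; rewrite big_nil tE.
by have [t tE] := atermD (TX j) IH g; exists t => M v; rewrite big_cons tE.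
Qed.

Lemma atermMn I (X : forall M, (I -> alg M) -> alg M) k :
  aterm X -> aterm (fun M v => X M v *+ k).
Proof.
move=> TX; elim: k => [|k IH] n g.
  by have [t tE] := aterm0 g; exists t => M v; rewrite tE mulr0n.
by have [t tE] := atermD TX IH g; exists t => M v; rewrite tE mulrS.
Qed.

Lemma atermMz I (X : forall M, (I -> alg M) -> alg M) (z : int) :
  aterm X -> aterm (fun M v => X M v *~ z).
Proof.
by case: z => k TX; [apply: atermMn|apply: atermN; apply: atermMn].
Qed.

Lemma atermX I (X : forall M, (I -> alg M) -> alg M) k :
  aterm X -> aterm (fun M v => X M v ^+ k).
Proof.
move=> TX; elim: k => [|k IH] n g.
  by have [t tE] := aterm1 g; exists t => M v; rewrite tE expr0.
by have [t tE] := atermM TX IH g; exists t => M v; rewrite tE exprS.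
Qed.

(** * Semialgebraic relations between scalars are existential *)

(** Scalars are represented in the algebra by the elements of the base field. *)
Definition scal (J : Type) (M : amodel) (k : J -> base M) : J -> alg M :=
  fun j => (k j)%:A.

Lemma scal_inj (M : amodel) : injective (fun k : base M => k%:A : alg M).
Proof.
move=> k l /eqP; rewrite -subr_eq0 -scalerBl scaler_eq0 oner_eq0 orbF subr_eq0.
by move/eqP.
Qed.

(** The language has no division, so the value of a polynomial with rational
    coefficients is not given by a term; its graph is existentially defined. *)
Definition egraph I (a : forall M : amodel, (I -> base M) -> base M) : Prop :=
  exists2 X : alg_family (option I), exdef X &
  forall (M : amodel) (k : I -> base M) b,
    X M (ocons b (scal k)) <-> b = (a M k)%:A.

Lemma egraph_op I (op : forall M : amodel, alg M -> alg M -> alg M)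
    (a b c : forall M : amodel, (I -> base M) -> base M) :
  (forall J X Y, aterm X -> aterm Y ->
     aterm (fun M (w : J -> alg M) => op M (X M w) (Y M w))) ->
  (forall M k, (c M k)%:A = op M (a M k)%:A (b M k)%:A) ->
  egraph a -> egraph b -> egraph c.
Proof.
move=> Top opE [X DX XE] [Y DY YE].
pose J := option (option (option I)).
pose f (o : option I) : J := if o is Some i then Some (Some o) else Some None.
pose f' (o : option I) : J := if o is Some i then Some (Some o) else None.
have D : exdef (fun M (w : J -> alg M) => X M (w \o f) /\ Y M (w \o f') /\
    w (Some (Some None)) = op M (w (Some None)) (w None)).
  apply: (def_and exdefP); first exact: (def_rename exdefP).
  apply: (def_and exdefP); first exact: (def_rename exdefP).
  by apply: exdef_eq; [|apply: Top]; apply: aterm_var.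
apply: (ex_intro2 _ _ _ (def_ex1 exdefP (def_ex1 exdefP D))) => M k d.
have fE x y : ocons y (ocons x (ocons d (scal k))) \o f = ocons x (scal k).
  by apply/funext => -[].
have fE' x y : ocons y (ocons x (ocons d (scal k))) \o f' = ocons y (scal k).
  by apply/funext => -[].
split=> [[x [y]]|dE].
  by rewrite fE fE' => -[/XE -> [/YE -> /= ->]]; rewrite opE.
exists (a M k)%:A, (b M k)%:A; rewrite fE fE'.
by split; [apply/XE|split; [apply/YE|rewrite /= dE opE]].
Qed.

Lemma egraph_term I (a : forall M : amodel, (I -> base M) -> base M)
    (X : forall M, (I -> alg M) -> alg M) :
  aterm X -> (forall M k, X M (scal k) = (a M k)%:A) -> egraph a.
Proof.
move=> TX XE; exists (fun M v => v None = X M (v \o Some)).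
  apply: exdef_eq; first exact: aterm_var.
  by move=> n g; have [t tE] := TX n (g \o Some); exists t.
by move=> M k b /=; rewrite -XE.
Qed.

Lemma nth_codom_ord (T : Type) (x0 : T) N (k : 'I_N -> T) (i : 'I_N) :
  nth x0 (codom k) i = k i.
Proof. by rewrite /codom /image_mem (nth_map i) ?size_enum_ord // nth_ord_enum. Qed.

Lemma egraph_teval N (t : qe_rcf.term rat) :
  egraph (fun M (k : 'I_N -> base M) => teval (codom k) t).
Proof.
elim: t => [i|c|n|t IHt u IHu|t IHt|t IHt n|t IHt u IHu|t IHt n].
- case: (ltnP i N) => ltiN.
    apply: (egraph_term (aterm_var (Ordinal ltiN))) => M k.
    by rewrite /teval /= (nth_codom_ord 0 k (Ordinal ltiN)).
  apply: (egraph_term (@aterm0 _)) => M k.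
  by rewrite /teval /= nth_default ?scale0r // size_codom card_ord.
(* A rational constant is defined by clearing its denominator. *)
- exists (fun M v => v None *~ denq c = 1 *~ numq c).
    have Tc := atermMz (denq c) (@aterm_var (option 'I_N) None).
    exact: (exdef_eq Tc (atermMz (numq c) (@aterm1 _))).
  move=> M k b /=; rewrite /teval /= -!scaler_int /ratr mulrC.
  have d0 : (denq c)%:~R != 0 :> base M by rewrite intr_eq0 denq_neq0.
  split=> [E|->]; last by rewrite scalerA mulVKf.
  by rewrite -scalerA -E scalerK.
- apply: (egraph_term (atermMn n (@aterm1 _))) => M k.
  by rewrite /teval /= scaler_nat.
- apply: (egraph_op (op := fun M x y => x + y) _ _ IHt IHu) => [J X Y|M k].
    exact: atermD.
  by rewrite /teval /= scalerDl.
- apply: (egraph_op (op := fun M x _ => - x) _ _ IHt IHt) => [J X Y|M k].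
    by move=> TX _; apply: atermN.
  by rewrite /teval /= scaleNr.
- apply: (egraph_op (op := fun M x _ => x *+ n) _ _ IHt IHt) => [J X Y|M k].
    by move=> TX _; apply: atermMn.
  by rewrite /teval /= scalerMnl.
- apply: (egraph_op (op := fun M x y => x * y) _ _ IHt IHu) => [J X Y|M k].
    exact: atermM.
  by rewrite /teval /= -scalerAl mul1r scalerA.
- apply: (egraph_op (op := fun M x _ => x ^+ n) _ _ IHt IHt) => [J X Y|M k].
    by move=> TX _; apply: atermX.
  by rewrite /teval /= exprZn expr1n.
Qed.

(** Relations between scalars that become existential relations between the
    corresponding elements of the algebra. *)
Definition scdef I (Y : forall M : amodel, (I -> base M) -> Prop) : Prop :=
  exists2 X : alg_family I, exdef X &
  forall (M : amodel) (k : I -> base M), X M (scal k) <-> Y M k.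

Lemma scdef_and I (Y Z : forall M : amodel, (I -> base M) -> Prop) :
  scdef Y -> scdef Z -> scdef (fun M k => Y M k /\ Z M k).
Proof.
move=> [X DX XE] [X' DX' XE']; apply: (ex_intro2 _ _ _ (def_and exdefP DX DX')).
by move=> M k; rewrite XE XE'.
Qed.

Lemma scdef_or I (Y Z : forall M : amodel, (I -> base M) -> Prop) :
  scdef Y -> scdef Z -> scdef (fun M k => Y M k \/ Z M k).
Proof.
move=> [X DX XE] [X' DX' XE']; apply: (ex_intro2 _ _ _ (exdef_or DX DX')).
by move=> M k; rewrite XE XE'.
Qed.

Lemma scdef_ext I (Y Z : forall M : amodel, (I -> base M) -> Prop) :
  (forall M k, Y M k <-> Z M k) -> scdef Y -> scdef Z.
Proof. by move=> YZ [X DX XE]; exists X => // M k; rewrite XE YZ. Qed.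

Lemma scdef_graph I (a b : forall M : amodel, (I -> base M) -> base M)
    (Z : forall M : amodel, base M -> base M -> Prop) (W : alg_family bool) :
  exdef W -> (forall (M : amodel) (w : bool -> alg M) x y,
     w false = x%:A -> w true = y%:A -> W M w <-> Z M x y) ->
  egraph a -> egraph b -> scdef (fun M k => Z M (a M k) (b M k)).
Proof.
move=> DW WZ [X DX XE] [Y DY YE].
pose J := option (option I).
pose f (o : option I) : J := if o is Some i then Some o else Some None.
pose f' (o : option I) : J := if o is Some i then Some o else None.
pose f'' (x : bool) : J := if x then None else Some None.
have D := def_and exdefP (def_rename exdefP f'' DW)
  (def_and exdefP (def_rename exdefP f DX) (def_rename exdefP f' DY)).
apply: (ex_intro2 _ _ _ (def_ex1 exdefP (def_ex1 exdefP D))) => M k.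
have fE x y : ocons y (ocons x (scal k)) \o f = ocons x (scal k).
  by apply/funext => -[].
have fE' x y : ocons y (ocons x (scal k)) \o f' = ocons y (scal k).
  by apply/funext => -[].
split=> [[x [y]]|Zab].
  by rewrite fE fE' => -[Wxy [/XE xE /YE yE]]; apply: (WZ M _ _ _ _ _).1 Wxy.
exists (a M k)%:A, (b M k)%:A; rewrite fE fE'.
by split; [apply/WZ|split; [apply/XE|apply/YE]].
Qed.

Lemma scdef_eq I (a b : forall M : amodel, (I -> base M) -> base M) :
  egraph a -> egraph b -> scdef (fun M k => a M k = b M k).
Proof.
apply: (@scdef_graph _ _ _ (fun M x y => x = y) (fun M w => w false = w true)).
  exact: exdef_eq (aterm_var _) (aterm_var _).
by move=> M w x y -> ->; split=> [/scal_inj|->].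
Qed.

(** In a real closed field, [x < y] holds exactly if [(y - x) * d^2 = 1] for
    some [d]; this is how the order becomes visible in the algebra. *)
Lemma scdef_lt I (a b : forall M : amodel, (I -> base M) -> base M) :
  egraph a -> egraph b -> scdef (fun M k => a M k < b M k).
Proof.
pose V (M : amodel) (w : option bool -> alg M) :=
  base_field (w None) /\
  (w (Some true) - w (Some false)) * w None * w None = 1.
have DV : exdef V.
  apply: (def_and exdefP); first by apply: exdef_base; apply: aterm_var.
  apply: exdef_eq; last exact: aterm1.
  do 2![apply: atermM; last exact: aterm_var].
  by apply: atermD; [|apply: atermN]; apply: aterm_var.
apply: (@scdef_graph _ _ _ (fun M x y => x < y) _ (def_ex1 exdefP DV)).
move=> M w x y xE yE; rewrite /V /= xE yE -subr_gt0 -scalerBl.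
split=> [[c [[d ->]]]|xy].
  rewrite !mulr_algr !scalerA -[RHS]scale1r => /scal_inj dd.
  have : 0 < (y - x) * (d * d) by rewrite mulrC dd.
  have [->|d0] := eqVneq d 0; first by rewrite !mulr0 ltxx.
  by rewrite pmulr_lgt0 // -expr2 exprn_even_gt0.
pose d := (Num.sqrt (y - x))^-1; exists d%:A; split; first by exists d.
rewrite !mulr_algr !scalerA -expr2 exprVn sqr_sqrtr ?ltW //.
by rewrite mulVf ?scale1r // gt_eqF.
Qed.

(** Negations are carried along because existential families are not closed
    under complement. *)
Lemma scdef_feval N (p : qe_rcf.formula rat) :
  scdef (fun M (k : 'I_N -> base M) => feval (codom k) p) /\
  scdef (fun M (k : 'I_N -> base M) => ~~ feval (codom k) p).
Proof.
have DT (b : bool) : scdef (fun M (k : 'I_N -> base M) => b).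
  case: b; first by exists (fun _ _ => True); [apply: def_true exdefP _|].
  by exists (fun _ _ => False); [apply: exdef_false|].
have eqD t u := scdef_eq (@egraph_teval N t) (@egraph_teval N u).
have ltD t u := scdef_lt (@egraph_teval N t) (@egraph_teval N u).
have le_or (R : rcfType) (x y : R) : x < y \/ x = y <-> x <= y.
  by rewrite le_eqVlt orbC; split=> [[->//|->]|/orP[|/eqP]]; rewrite ?eqxx ?orbT; auto.
elim: p => [b|t u|t u|t u|p [p1 p2] q [q1 q2]|p [p1 p2] q [q1 q2]|p [p1 p2] q [q1 q2]
  |p [p1 p2]]; rewrite /feval /=.
- by split; apply: DT.
- split; first by apply: scdef_ext (eqD t u) => M k; split=> /eqP.
  apply: scdef_ext (scdef_or (ltD t u) (ltD u t)) => M k.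
  by rewrite neq_lt; split=> /orP.
- split; first exact: (ltD t u).
  apply: scdef_ext (scdef_or (ltD u t) (eqD u t)) => M k.
  by rewrite -leNgt; apply: le_or.
- split; last by apply: scdef_ext (ltD u t) => M k; rewrite -ltNge.
  apply: scdef_ext (scdef_or (ltD t u) (eqD t u)) => M k.
  exact: le_or.
- split; first by apply: scdef_ext (scdef_and p1 q1) => M k; split=> /andP.
  by apply: scdef_ext (scdef_or p2 q2) => M k; rewrite negb_and; split=> /orP.
- split; first by apply: scdef_ext (scdef_or p1 q1) => M k; split=> /orP.
  by apply: scdef_ext (scdef_and p2 q2) => M k; rewrite negb_or; split=> /andP.
- split; first by apply: scdef_ext (scdef_or p2 q1) => M k; rewrite implybE; split=> /orP.
  by apply: scdef_ext (scdef_and p1 q2) => M k; rewrite negb_imply; split=> /andP.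
- by split=> //; apply: scdef_ext p1 => M k; rewrite negbK.
Qed.

Lemma semialg_scdef (J : finType) (Y : field_family J) :
  semialg Y -> scdef (fun M k => Y (base M) k).
Proof.
move=> DY.
have [p pE] := DY (fun j => nat_of_ord (enum_rank j)) #|J| (fun j => ltn_ord _).
have [[X DX XE] _] := scdef_feval #|J| p.
pose ev (i : 'I_#|J|) : J := enum_val i.
exists (fun M v => X M (v \o ev)); first exact: (def_rename exdefP).
move=> M k; rewrite -[scal k \o _]/(scal (k \o ev)) XE pE.
suff -> : (fun j => (codom (k \o ev))`_(enum_rank j)) = k by [].
by apply/funext => j; rewrite nth_codom_ord /ev /= enum_rankK.
Qed.

(** * Frames: coordinate systems of an algebra *)

Section Frames.
Variables (M : amodel) (e : 'I_m -> alg M).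

Definition lin (a : 'I_m -> base M) : alg M := \sum_i a i *: e i.

(** The family [e], not assumed to be a basis, satisfies the multiplication table
    with parameters [d]. These conditions are existential, unlike linear
    independence. *)
Record frame (d : param -> base M) : Prop := Frame {
  frame_mul : forall i j, e i * e j = lin (fun k => d (Pmul i j k));
  frame_sig : forall i, inv (e i) = lin (fun k => d (Psig i k));
  frame_trd : forall i, trd (e i) = lin (fun k => d (Ptrd i k));
  frame_one : 1 = lin (d \o Pone);
  frame_cone : cone (lin (d \o Pcone)) }.

(** For [lin_smul], [inv_lin] and [trd_lin]: a map that is given on coordinates
    by a matrix is linear. *)
Lemma lin_sum (J : finType) (c : J -> base M) (a : J -> 'I_m -> base M) :
  lin (fun k => \sum_j c j * a j k) = \sum_j c j *: lin (a j).
Proof.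
rewrite /lin; under eq_bigr do rewrite scaler_suml.
rewrite exchange_big; apply: eq_bigr => j _; rewrite scaler_sumr.
by apply: eq_bigr => k _; rewrite scalerA.
Qed.

Lemma lin0 : lin (fun=> 0) = 0.
Proof. by rewrite /lin big1 // => i _; rewrite scale0r. Qed.

Variables (d : param -> base M) (fr : frame d).

Lemma lin_smul a b : lin (smul d a b) = lin a * lin b.
Proof.
rewrite [RHS]mulr_suml; under [RHS]eq_bigr do rewrite mulr_sumr.
rewrite [LHS](_ : _ = lin (fun k => \sum_i a i * \sum_j b j * d (Pmul i j k))).
  rewrite (lin_sum a (fun i k => \sum_j b j * d (Pmul i j k))).
  apply: eq_bigr => i _.
  rewrite (lin_sum b (fun j k => d (Pmul i j k))) scaler_sumr.
  apply: eq_bigr => j _; rewrite -frame_mul //.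
  by rewrite -scalerAl -scalerAr.
congr lin; apply/funext => k; apply: eq_bigr => i _; rewrite mulr_sumr.
by apply: eq_bigr => j _; rewrite mulrA.
Qed.

Lemma inv_lin a : inv (lin a) = lin (ssig d a).
Proof.
have csa := amodel_csa M; have [_ _ [iD _ _] _ _] := csa.
rewrite /lin (big_morph _ iD (sigma0 csa)) -/(lin _) lin_sum.
by apply: eq_bigr => i _; rewrite (sigmaZ csa) (frame_sig fr).
Qed.

Lemma trd_lin a : trd (lin a) = lin (strd d a).
Proof.
have tD x y : trd (x + y) = trd x + trd y :> alg M.
  by have := amodel_trd 1 x y; rewrite !scale1r.
have t0 : trd (0 : alg M) = 0.
  by have := amodel_trd (-1) (0 : alg M) 0; rewrite scaler0 addr0 scaleN1r addNr.
have tZ c x : trd (c *: x) = c *: trd x :> alg M.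
  by have := amodel_trd c x 0; rewrite !addr0 t0 addr0.
rewrite /lin (big_morph _ tD t0) -/(lin _) lin_sum.
by apply: eq_bigr => i _; rewrite tZ (frame_trd fr).
Qed.

Lemma lin_scone x : lin (scone d x) =
  \sum_l inv (lin (fun i => x (l, i))) * lin (d \o Pcone) * lin (fun i => x (l, i)).
Proof.
rewrite {1}/lin; under eq_bigr do rewrite scaler_suml.
rewrite exchange_big; apply: eq_bigr => l _.
by rewrite -[LHS]/(lin _) !lin_smul inv_lin.
Qed.

(** [lin] is a unital homomorphism from the algebra in coordinates, and this
    algebra is simple: a nonzero [y] in the kernel would put 1 in the kernel. *)
Lemma ssimple_lin_inj : ssimple d -> injective lin.
Proof.
move=> sd a b ab; pose y k := a k - b k.
have ly : lin y = 0.
  by rewrite /lin; under eq_bigr do rewrite scalerBl; rewrite sumrB; apply/eqP;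
    rewrite subr_eq0; apply/eqP.
have [y0|y0] := EM (y = fun=> 0).
  by apply/funext => k; apply/eqP; rewrite -subr_eq0 -[a k - b k]/(y k) y0.
have [z [w one]] := sd y y0; have := frame_one fr; rewrite one.
rewrite {1}/lin; under eq_bigr do rewrite scaler_suml.
rewrite exchange_big big1 => [/eqP|l _]; first by rewrite oner_eq0.
by rewrite -[LHS]/(lin _) !lin_smul ly mulr0 mul0r.
Qed.

Hypothesis linI : injective lin.

(** An independent family of [m] elements is a basis. *)
Lemma lin_surj : forall x, exists a, x = lin a.
Proof.
pose X := [tuple e i | i < m].
have XE (a : 'I_m -> base M) : \sum_(i < m) a i *: X`_i = lin a.
  by apply: eq_bigr => i _; rewrite -[X`_i]tnth_nth tnth_mktuple.
have freeX : free X.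
  apply/freeP => a; rewrite XE -lin0 => /linI -> //.
have basisX : basis_of fullv X.
  rewrite basisEfree freeX subvf size_tuple /=.
  by have [_ _ _ _ ->] := amodel_csa M.
move=> x; exists (fun i => coord X i x).
by rewrite -XE; exact: (coord_basis basisX (memvf x)).
Qed.

Hypothesis cone_n0 : d \o Pcone <> fun=> 0.

(** The cone is the only symbol for which the frame does not give compatibility
    directly: this is [cone_generated]. *)
Lemma lin_embedding : @embedding L (sstruct d) (str M) lin.
Proof.
split=> //.
  case=> [[]|] a /=.
  - exact: lin0.
  - by rewrite -(frame_one fr).
  - by rewrite /lin -big_split; apply: eq_bigr => i _; rewrite scalerDl.
  - by rewrite /lin -sumrN; apply: eq_bigr => i _; rewrite scaleNr.
  - exact: lin_smul.
  - by rewrite inv_lin.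
  - by rewrite trd_lin.
have p0 : lin (d \o Pcone) != 0.
  by apply/eqP; rewrite -lin0 => /linI.
have coneE := cone_generated (amodel_csa M) (amodel_cone M) (frame_cone fr) p0.
case=> [[]|] a /=.
  have oneE c : lin (fun k => c * d (Pone k)) = c%:A.
    have := lin_sum (fun _ : unit => c) (fun _ => d \o Pone).
    rewrite -(frame_one fr) big_const card_unit /= addr0 => <-.
    by congr lin; apply/funext => k; rewrite big_const card_unit /= addr0.
  split=> [[c ->]|[c cE]]; first by exists (c tt); rewrite oneE.
  by exists (fun=> c); apply: linI; rewrite oneE.
rewrite coneE; split=> [[x ->]|[y yE]].
  by exists (fun l => lin (fun i => x (l, i))); rewrite lin_scone.
have [x xE] := choice (fun l => lin_surj (y l)).
exists (fun li => x li.1 li.2); apply: linI; rewrite lin_scone yE.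
by apply: eq_bigr => l _; rewrite !xE.
Qed.

Lemma lin_elementary : @elementary L (sstruct d) (str M) lin.
Proof.
apply: isomorphism_elementary lin_embedding _ => x.
by have [a ->] := lin_surj x; exists a.
Qed.

(** Converse of [ssimple_lin_inj]: for a basis, the simplicity condition is
    satisfied. *)
Lemma frame_ssimple : ssimple d.
Proof.
move=> y y0.
have ly0 : lin y != 0 by apply/eqP; rewrite -lin0 => /linI.
have [w wE] := basis_spread (amodel_csa M)
  (fun x => let: ex_intro a aE := lin_surj x in ex_intro _ a aE) ly0.
have [z zE] := choice (fun l => lin_surj (e l)).
have [w' w'E] := choice (fun l => lin_surj (w l)).
exists (fun li => z li.1 li.2), (fun li => w' li.1 li.2); apply: linI.
rewrite -(frame_one fr) wE {2}/lin; under [RHS]eq_bigr do rewrite scaler_suml.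
rewrite exchange_big; apply: eq_bigr => l _.
by rewrite -[RHS]/(lin _) !lin_smul -zE -w'E.
Qed.

End Frames.

Lemma basis_exists (F : fieldType) (A : falgType F) n : \dim {:A} = n ->
  exists e : 'I_n -> A,
    injective (fun a : 'I_n -> F => \sum_i a i *: e i) /\
    forall x, exists a : 'I_n -> F, x = \sum_i a i *: e i.
Proof.
move=> <-; set X := vbasis {:A}; exists (fun i => X`_i).
have bX : basis_of {:A} X by apply: vbasisP.
split=> [a b ab|x]; last first.
  by exists (fun i => coord X i x); apply: coord_basis bX _; apply: memvf.
apply/funext => i; rewrite -(coord_sum_free a i (basis_free bX)) ab.
by rewrite coord_sum_free ?(basis_free bX).
Qed.

Lemma frame_exists (M : amodel) : exists (e : 'I_m -> alg M) (d : param -> base M),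
  [/\ frame e d, injective (lin e) & d \o Pcone <> fun=> 0].
Proof.
have csa := amodel_csa M; have [_ _ _ _ dimA] := csa.
have [e [eI eS]] := basis_exists dimA.
have [p Pp p0] := cone_neq0 (amodel_cone M).
have [c cE] := choice eS.
pose d (q : param) : base M := match q with
  | inl (inl (inl (inl (i, j, k)))) => c (e i * e j) k
  | inl (inl (inl (inr (i, j)))) => c (inv (e i)) j
  | inl (inl (inr (i, j))) => c (trd (e i)) j
  | inl (inr i) => c 1 i
  | inr i => c p i
  end.
exists e, d; split=> //; first by split=> *; rewrite -?cE //; rewrite -[lin _ _]cE.
move=> dp; case/eqP: p0; rewrite (cE p) -[LHS]/(lin e (d \o Pcone)) dp.
exact: lin0.
Qed.

(** The formula [q] says: there are elements [e i] and scalars that form a frame,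
    with the given tuple having certain coordinates, such that the parameters
    satisfy the semialgebraic condition [Y]. The first two parts of [Y] force
    the frame to be an isomorphism, and the third is [p] in coordinates. *)
Lemma sat_preserved n (p : formula L n) : exists2 q : formula L n, preserved q &
  forall (M : amodel) (v : 'I_n -> alg M), sat (str M) q v <-> sat (str M) p v.
Proof.
pose Q : finType := (param + 'I_n * 'I_m)%type.
pose Y : field_family Q := fun R k =>
  [/\ ssimple (k \o inl), k \o (inl \o Pcone) <> fun=> 0 &
  @sat L (sstruct (k \o inl)) n p (fun i => k \o (fun l => inr (i, l)))].
have DY : semialg Y.
  have D1 := semialg_ssimple (inl : param -> Q).
  have D2 : semialg (fun R (k : Q -> R) => k \o (inl \o Pcone) <> fun=> 0).
    apply: semialg_not; apply: semialg_veq; first exact: upolys_var.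
    by move=> k; apply: upoly0.
  have D3 := semialg_sat p (inl : param -> Q) (fun i l => inr (i, l)).
  apply: def_ext (def_and semialgP D1 (def_and semialgP D2 D3)) => R k.
  by split=> [[? []]|[]].
have [X DX XE] := semialg_scdef DY.
pose I := ('I_n + 'I_m + Q)%type.
pose el (M : amodel) (v : I -> alg M) (f : 'I_m -> Q) : alg M :=
  \sum_k v (inr (f k)) * v (inl (inr k)).
pose V (M : amodel) (v : I -> alg M) :=
  (forall q, base_field (v (inr q))) /\
  (forall ij : 'I_m * 'I_m, v (inl (inr ij.1)) * v (inl (inr ij.2)) =
     el M v (fun k => inl (Pmul ij.1 ij.2 k))) /\
  (forall i, inv (v (inl (inr i))) = el M v (fun k => inl (Psig i k))) /\
  (forall i, trd (v (inl (inr i))) = el M v (fun k => inl (Ptrd i k))) /\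
  1 = el M v (inl \o Pone) /\
  cone (el M v (inl \o Pcone)) /\
  (forall i, v (inl (inl i)) = el M v (fun k => inr (i, k))) /\
  X M (v \o inr).
have Tel f : aterm (fun M v => el M v f).
  by apply: aterm_sum => k; apply: atermM; apply: aterm_var.
have DV : exdef V.
  do ![apply: (def_and exdefP)].
  - by apply: (def_forall_fin exdefP) => q; apply: exdef_base; apply: aterm_var.
  - apply: (def_forall_fin exdefP) => ij; apply: exdef_eq => //.
    by apply: atermM; apply: aterm_var.
  - apply: (def_forall_fin exdefP) => i; apply: exdef_eq => //.
    by apply: aterm_inv; apply: aterm_var.
  - apply: (def_forall_fin exdefP) => i; apply: exdef_eq => //.
    by apply: aterm_trd; apply: aterm_var.
  - by apply: exdef_eq => //; apply: aterm1.
  - exact: exdef_cone.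
  - by apply: (def_forall_fin exdefP) => i; apply: exdef_eq => //; apply: aterm_var.
  - exact: (def_rename exdefP).
have DW := def_ex exdefP (def_ex exdefP DV).
have [q qq qE] := DW n id; exists q => // M v; rewrite qE => {q qq qE DW DV}.
have elE w e (k : Q -> base M) f :
    el M (sumv (sumv w e) (scal k)) f = lin e (k \o f).
  by apply: eq_bigr => i _ /=; rewrite mulr_algl.
split=> [[e [k' [k'F [mulE [sigE [trdE [oneE [coneE [vE XM]]]]]]]]]|Mp].
  have [k kE] := choice k'F.
  have {}kE : k' = scal k by apply/funext => x; apply: kE.
  rewrite {}kE {k' k'F} in mulE sigE trdE oneE coneE vE XM.
  have /XE[simp pc Sp] : X M (scal k) := XM.
  have fr : frame e (k \o inl).
    split=> [i j|i|i||]; rewrite -?elE //.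
    - by rewrite -[RHS](elE v) -(mulE (i, j)).
    - by rewrite -[RHS](elE v) -sigE.
    - by rewrite -[RHS](elE v) -trdE.
    - by rewrite -[RHS](elE v) -oneE.
    - by rewrite -[X in cone X](elE v).
  (* The point of the simplicity condition: [e] is a basis. *)
  have linI := ssimple_lin_inj fr simp.
  have -> : v = lin e \o (fun i => k \o (fun l => inr (i, l))).
    by apply/funext => i; rewrite -[LHS]/((v \o id) i) [LHS]vE elE.
  exact: (lin_elementary fr linI pc p _).1 Sp.
have [e [d [fr linI pc]]] := frame_exists M.
have [c cE] := choice (fun i => lin_surj linI (v i)).
pose k (x : Q) : base M := match x with inl y => d y | inr il => c il.1 il.2 end.
exists e, (scal k); split; first by move=> x; exists (k x).
split; first by move=> ij; rewrite elE -[LHS]/(e ij.1 * e ij.2) (frame_mul fr).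
split; first by move=> i; rewrite elE -[LHS]/(inv (e i)) (frame_sig fr).
split; first by move=> i; rewrite elE -[LHS]/(trd (e i)) (frame_trd fr).
split; first by rewrite elE (frame_one fr).
split; first by rewrite elE; apply: (frame_cone fr).
split; first by move=> i; rewrite elE -[LHS]/(v i) cE.
apply/XE; split; [exact: frame_ssimple fr linI|exact: pc|].
apply/(lin_elementary fr linI pc); move: Mp; congr sat.
by apply/funext => i; rewrite cE.
Qed.

End Interpretation.

Lemma model_complete_subclass m (K : structure L_CSA_I_P_Trd -> Prop) :
  (forall S, K S -> exists M : amodel m, S = str M) ->
  model_complete (theory_of K).
Proof.
move=> KE; apply: model_complete_preserved => n p.
by have [q qq qE] := sat_preserved m p; exists q => // S /KE[M ->].
Qed.

(** * The language without the trace *)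

Section IdentityTrace.
Notation L := L_CSA_I_P_Trd.

(** The identity is a linear function that a term can define, so formulas that use
    it as the trace can be translated back. *)
Definition expand_id (S : structure L_CSA_I_P) : structure L :=
  @expand_fun L_CSA_I_P 1 S (fun a => a ord0).

Lemma erase_term n (t : term L n) : exists t' : term L_CSA_I_P n,
  forall (S : structure L_CSA_I_P) (v : 'I_n -> S),
    eval v t' = @eval L (expand_id S) n v t.
Proof.
elim: t => [i|[f|] a IH]; first by exists (Var _ i).
  have [a' aE] := choice IH; exists (@App L_CSA_I_P n f a') => S v /=.
  by congr finterp; apply/funext => i; apply: aE.
by have [t' tE] := IH ord0; exists t' => S v; rewrite tE.
Qed.

Lemma erase_formula n (p : formula L n) : exists p' : formula L_CSA_I_P n,
  forall (S : structure L_CSA_I_P) (v : 'I_n -> S),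
    sat S p' v <-> @sat L (expand_id S) n p v.
Proof.
elim: p => {n} [n|n t u|n r a|n p [p' pE] q [q' qE]|n p [p' pE]].
- by exists (Bot _ n).
- have [t' tE] := erase_term t; have [u' uE] := erase_term u.
  by exists (Eq t' u') => S v /=; rewrite tE uE.
- have [a' aE] := choice (fun i => erase_term (a i)).
  exists (@Rel L_CSA_I_P n r a') => S v /=.
  suff -> : (fun i => eval v (a' i)) =
            (fun i => @eval L (expand_id S) n v (a i)) by [].
  by apply/funext => i; apply: aE.
- by exists (Imp p' q') => S v /=; rewrite pE qE.
- by exists (All p') => S v /=; split=> h x; apply/pE; apply: h.
Qed.

Fixpoint include_term n (t : term L_CSA_I_P n) : term L n :=
  match t with
  | Var i => Var L i
  | App f a => @App L n (Some f) (fun i => include_term (a i))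
  end.

Fixpoint include_formula n (p : formula L_CSA_I_P n) : formula L n :=
  match p in formula _ n return formula L n with
  | Bot n => Bot L n
  | Eq _ t u => Eq (include_term t) (include_term u)
  | Rel n r a => @Rel L n r (fun i => include_term (a i))
  | Imp _ p q => Imp (include_formula p) (include_formula q)
  | All _ p => All (include_formula p)
  end.

Lemma eval_include_term (S : structure L_CSA_I_P) n (v : 'I_n -> S) t :
  @eval L (expand_id S) n v (include_term t) = eval v t.
Proof.
by elim: t => [//|f a IH] /=; congr finterp; apply/funext => i; apply: IH.
Qed.

Lemma sat_include_formula (S : structure L_CSA_I_P) n (p : formula L_CSA_I_P n) v :
  @sat L (expand_id S) n (include_formula p) v <-> sat S p v.
Proof.
elim: p v => {n} [n|n t u|n r a|n p IHp q IHq|n p IHp] v //=.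
- by rewrite !eval_include_term.
- suff -> : (fun i => @eval L (expand_id S) n v (include_term (a i))) =
            (fun i => @eval L_CSA_I_P S n v (a i)) by [].
  by apply/funext => i; apply: eval_include_term.
- by rewrite IHp IHq.
- by split=> h x; apply/IHp; apply: h.
Qed.

(** Expanding by the identity changes neither the embeddings nor, by the two
    translations, the sentences that hold and the definable relations. *)
Lemma model_complete_expand_id (K : structure L_CSA_I_P -> Prop) :
  model_complete (theory_of (fun S => exists2 S0, K S0 & S = expand_id S0)) ->
  model_complete (theory_of K).
Proof.
move=> mc M N MK NK h [hI hf hr] n p v.
have expand_model S : is_model (theory_of K) S ->
    is_model (theory_of (fun S => exists2 S0, K S0 & S = expand_id S0)) (expand_id S).
  move=> SK p' Tp'; have [q qE] := erase_formula p' => w; apply/qE.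
  apply: SK => S0 KS0 w0; apply/qE; apply: Tp'; by exists S0.
rewrite -!sat_include_formula.
apply: (mc _ _ (expand_model _ MK) (expand_model _ NK) h).
by split=> // -[f|] a //=; apply: hf.
Qed.

End IdentityTrace.

Theorem proposition3p12 (m : nat) :
  model_complete (OCSA_I_rcf m) /\ model_complete (OCSA_I_rcf_Trd m).
Proof.
split.
  apply/model_complete_expand_id/(@model_complete_subclass m).
  move=> _ [_ [F A sigma P csa [cP _]] ->].
  have idL k a b : id (k *: a + b) = k *: id a + id b :> A by [].
  by exists (AModel csa cP idL).
apply: (@model_complete_subclass m) => _ [F A sigma P Trd csa [cP _] red].
by exists (AModel csa cP (reduced_trace_linear csa red)).
Qed.
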